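(* Let $0<\alpha<1$ and $\beta=\alpha$. Then the essential norm of the $\beta$-Ces\`aro operator $C_\alpha:\mathcal{B}_\alpha^0\to\mathcal{B}_\alpha^0$ is $0$.
   Context: $\mathbb{D}=\{z\in\mathbb{C}:|z|<1\}$. For $\alpha>0$, the $\alpha$-Bloch space $\mathcal{B}_\alpha$ is the space of analytic functions $f$ on $\mathbb{D}$ with $\|f\|_{\mathcal{B}_\alpha}:=\sup_{z\in\mathbb{D}}(1-|z|^2)^\alpha|f'(z)|<\infty$. $\mathcal{B}_\alpha^0=\{f\in\mathcal{B}_\alpha: f(0)=0\}$, normed by $\|\cdot\|_{\mathcal{B}_\alpha}$. For $\beta\in\mathbb{R}$, $C_\beta(f)(z)=\int_0^z \frac{f(w)}{w(1-w)^\beta}\,dw$ (principal branch). The essential norm of a bounded operator $T:X\to Y$ between Banach spaces is $\|T\|_e=\inf\{\|T+K\|: K:X\to Y \text{ compact}\}$. *)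

(* Defs.v *)
From HB Require Import structures.
From mathcomp Require Import all_boot all_order all_algebra.
From mathcomp Require Import all_classical all_reals all_analysis.
From mathcomp Require Import complex.
Import Order.TTheory GRing.Theory Num.Theory numFieldNormedType.Exports.

Set Implicit Arguments.
Unset Strict Implicit.
Unset Printing Implicit Defensive.

Local Open Scope classical_set_scope.
Local Open Scope ring_scope.

Section BlochCesaro.
Variable R : realType.

(* The complex plane, viewed as a normed module over itself, so that
   [derivable f z 1] is complex differentiability and [derive1 f] is f'. *)
Definition Cplx : Type := (R[i])^o.

Definition cabs (u : R[i]) : R := Num.sqrt (complex.Re u ^+ 2 + complex.Im u ^+ 2).

Definition disc : set Cplx := [set z | cabs (z : R[i]) < 1].

Definition holomorphic_on (D : set Cplx) (f : Cplx -> Cplx) : Prop :=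
  forall z, D z -> derivable f z 1.

Definition bloch_norm (alpha : R) (f : Cplx -> Cplx) : \bar R :=
  ereal_sup [set ((1 - cabs (z : R[i]) ^+ 2) `^ alpha
                   * cabs (derive1 f z : R[i]))%:E | z in disc].

(* B_alpha^0 : analytic functions on D with f(0) = 0 and finite Bloch norm.
   Functions are represented by C -> C maps vanishing off the disc, so that
   this set is in bijection with the genuine space of functions on D. *)
Definition bloch0 (alpha : R) : set (Cplx -> Cplx) :=
  [set f | holomorphic_on disc f /\ f 0 = 0 /\
           (forall z, ~ disc z -> f z = 0) /\
           (bloch_norm alpha f < +oo)%E].

Definition carg (u : R[i]) : R :=
  let x := complex.Re u in let y := complex.Im u in
  if 0 < x then atan (y / x)
  else if x < 0 then (if 0 <= y then atan (y / x) + pi else atan (y / x) - pi)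
  else if 0 < y then pi / 2 else if y < 0 then - (pi / 2) else 0.

Definition cpow (u : R[i]) (b : R) : R[i] :=
  if u == 0 then 0
  else Complex (cabs u `^ b * cos (b * carg u)) (cabs u `^ b * sin (b * carg u)).

Definition cint01 (F : R -> R[i]) : R[i] :=
  Complex (Rintegral lebesgue_measure `[0%R, 1%R] (fun t => complex.Re (F t)))
          (Rintegral lebesgue_measure `[0%R, 1%R] (fun t => complex.Im (F t))).

(* beta-Cesaro operator:
   C_beta f (z) = int_0^z f(w) / (w (1-w)^beta) dw, integrated along the
   segment w = t z, t in [0,1] (dw = z dt); set to 0 off the disc. *)
Definition cesaro_op (beta : R) (f : Cplx -> Cplx) : Cplx -> Cplx :=
  fun z => if `[< disc z >] then
    cint01 (fun t => let w : R[i] := Complex t 0 * (z : R[i]) in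
                     (f w : R[i]) * (z : R[i]) / (w * cpow (1 - w) beta))
  else 0.

Definition opnorm (alpha : R) (T : (Cplx -> Cplx) -> (Cplx -> Cplx)) : \bar R :=
  ereal_sup [set bloch_norm alpha (T f) |
             f in [set f | bloch0 alpha f /\ (bloch_norm alpha f <= 1)%E]].

Definition compact_op (alpha : R) (K : (Cplx -> Cplx) -> (Cplx -> Cplx)) : Prop :=
  (forall f, bloch0 alpha f -> bloch0 alpha (K f)) /\
  (forall (a b : R[i]) f g, bloch0 alpha f -> bloch0 alpha g ->
     K (fun z => a * f z + b * g z) = (fun z => a * K f z + b * K g z)) /\
  (forall u : nat -> (Cplx -> Cplx),
     (forall n, bloch0 alpha (u n) /\ (bloch_norm alpha (u n) <= 1)%E) ->
     exists phi : nat -> nat, (forall n, (phi n < phi n.+1)%N) /\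
     exists g, bloch0 alpha g /\
       forall e : R, 0 < e -> \forall n \near \oo,
         (bloch_norm alpha (fun z => (K (u (phi n)) z - g z)%R) < e%:E)%E).

Definition ess_norm (alpha : R) (T : (Cplx -> Cplx) -> (Cplx -> Cplx)) : \bar R :=
  ereal_inf [set opnorm alpha (fun f z => T f z + K f z) | K in compact_op alpha].

End BlochCesaro.

(* Main.v *)
(* The operator [C] is compact on [B_alpha^0], so [K = - C] annihilates it.
   Since [(C f)' (z) = f z / (z (1 - z)^alpha)] and [1 - |z|^2 <= 2 |1 - z|],
   the Bloch norm of [C f] is at most [8 sup |f|]: near the origin the quotient
   [f z / z] is controlled by Cauchy's estimate.  It remains to see that the
   unit ball of [B_alpha^0] is precompact for the sup norm.  For [alpha < 1] it
   is bounded and equicontinuous on the whole disc, so a sequence in it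
   converges uniformly along any ultrafilter; by Cauchy's estimate again the
   limit is in the ball, and a subsequence is read off the ultrafilter.

   Holomorphy only means complex differentiability, but the derivatives at hand
   are locally bounded, so dominated convergence permits differentiation of
   [int_0^1 k(t, z) dt] in [z].  With [k(t, z) = F(t z) / t] this gives the
   primitive of [F z / z] along rays; with [k(t, z) = v(a + z e(t)) e(-t)],
   [e(t) = exp(2 pi i t)], the integral [Psi] satisfies [Psi(u z) = u Psi(z)]
   for [|u| = 1], hence [z Psi'(z) = Psi(z)] and [Psi(x) = x v'(a)]: this is
   Cauchy's estimate. *)
Require Import Defs.
From HB Require Import structures.
From mathcomp Require Import all_boot all_order all_algebra.
From mathcomp Require Import all_classical all_reals all_analysis.
From mathcomp Require Import complex ring lra measurable_realfun.
Import Order.TTheory GRing.Theory Num.Theory numFieldNormedType.Exports.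
Local Open Scope classical_set_scope.
Local Open Scope ring_scope.
Set Implicit Arguments.
Unset Strict Implicit.
Unset Printing Implicit Defensive.

(** * Modulus and complex differentiability *)

Section ComplexModulus.
Variable R : realType.
Implicit Types (x y z w : R[i]) (a b t : R).

(** Bounds on [f] are drawn from bounds on [f'] by a mean value inequality whose majorant is an
    arbitrary differentiable function along the segment. A constant majorant would be useless near
    the unit circle, where the Bloch condition only gives [|f'(z)| <= (1 - |z|)^(-alpha)]. Along a
    radius this has an antiderivative proportional to [(1 - |z|)^(1 - alpha)], which tends to 0 at
    the circle exactly because [alpha < 1]: hence equicontinuity up to the boundary, and convergence
    that is uniform on all of D, not only on compact subsets as normal families would give. The
    bound by [8 sup |f|] needs nothing less.

    An ultrafilter yields limits at all points of D at once, for the functions as well as for their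
    derivatives; no countable dense set and no diagonal extraction occur. The only extraction comes
    at the very end, when a subsequence has to be exhibited. *)

Lemma cabsE z : cabs z = Normc.normc z.
Proof. by case: z. Qed.

Lemma cabs_norm z : `|z| = (cabs z)%:C%C.
Proof. by rewrite normc_def. Qed.

Lemma cabs_ge0 z : 0 <= cabs z.
Proof. exact: sqrtr_ge0. Qed.

Lemma cabs0 : cabs (0 : R[i]) = 0.
Proof. by rewrite cabsE Normc.normc0. Qed.

Lemma cabs1 : cabs (1 : R[i]) = 1.
Proof. by rewrite cabsE Normc.normc1. Qed.

Lemma cabs_eq0 z : (cabs z == 0) = (z == 0).
Proof.
apply/eqP/eqP => [|->]; last exact: cabs0.
by rewrite cabsE; exact: Normc.eq0_normc.
Qed.

Lemma cabs_gt0 z : (0 < cabs z) = (z != 0).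
Proof. by rewrite lt_def cabs_eq0 cabs_ge0 andbT. Qed.

Lemma cabsM z w : cabs (z * w) = cabs z * cabs w.
Proof. by rewrite !cabsE Normc.normcM. Qed.

Lemma cabsV z : cabs z^-1 = (cabs z)^-1.
Proof. by rewrite !cabsE Normc.normcV. Qed.

Lemma cabsN z : cabs (- z) = cabs z.
Proof. by rewrite /cabs !raddfN !sqrrN. Qed.

Lemma cabsD z w : cabs (z + w) <= cabs z + cabs w.
Proof. by rewrite !cabsE; exact: le_normcD. Qed.

Lemma cabsB z w : cabs (z - w) <= cabs z + cabs w.
Proof. by rewrite -[cabs w]cabsN; exact: cabsD. Qed.

Lemma cabsC z w : cabs (z - w) = cabs (w - z).
Proof. by rewrite -cabsN opprB. Qed.

Lemma cabs_split w z y : cabs (z - y) <= cabs (z - w) + cabs (w - y).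
Proof. by rewrite (_ : z - y = z - w + (w - y)) ?cabsD//; ring. Qed.

Lemma cabs_lerB z w : cabs z - cabs w <= cabs (z - w).
Proof. by rewrite lerBlDr -{1}(subrK w z); exact: cabsD. Qed.

Lemma cabs_real a : cabs a%:C%C = `|a|.
Proof. by rewrite /cabs/= expr0n addr0 sqrtr_sqr. Qed.

Lemma Re_cabs z : `|complex.Re z| <= cabs z.
Proof.
by rewrite -sqrtr_sqr /cabs ler_wsqrtr// lerDl sqr_ge0.
Qed.

Lemma Im_cabs z : `|complex.Im z| <= cabs z.
Proof.
by rewrite -sqrtr_sqr /cabs ler_wsqrtr// lerDr sqr_ge0.
Qed.

Lemma cabs_ReIm z : cabs z <= `|complex.Re z| + `|complex.Im z|.
Proof.
rewrite -(ler_pXn2r (ltn0Sn 1)) ?nnegrE ?cabs_ge0 ?addr_ge0//.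
rewrite sqr_sqrtr ?addr_ge0 ?sqr_ge0// sqrrD !real_normK ?num_real//.
by rewrite -addrA lerD2l lerDr mulrn_wge0// mulr_ge0.
Qed.

Lemma eq_ReIm z w :
  complex.Re z = complex.Re w -> complex.Im z = complex.Im w -> z = w.
Proof. by case: z w => [a b] [c d] /= -> ->. Qed.

Lemma cReM z w : complex.Re (z * w) =
  complex.Re z * complex.Re w - complex.Im z * complex.Im w.
Proof. by case: z w => [a b] [c d]. Qed.

Lemma cImM z w : complex.Im (z * w) =
  complex.Re z * complex.Im w + complex.Im z * complex.Re w.
Proof. by case: z w => [a b] [c d]. Qed.

(* A unimodular rotation making [z] real reduces complex mean-value and
   integral estimates to real ones. *)
Lemma unimodular_rotation z :
  exists2 c, cabs c = 1 & complex.Re (c * z) = cabs z.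
Proof.
have [->|z0] := eqVneq z 0; first by exists 1; rewrite ?cabs1// mulr0 cabs0.
exists ((cabs z)%:C%C / z); last by rewrite mulfVK.
by rewrite cabsM cabsV cabs_real ger0_norm ?cabs_ge0// divff// cabs_eq0.
Qed.

Lemma Re_rotation_le c z : cabs c = 1 -> complex.Re (c * z) <= cabs z.
Proof.
move=> c1; rewrite -[leRHS]mul1r -c1 -cabsM.
exact: le_trans (ler_norm _) (Re_cabs _).
Qed.

End ComplexModulus.

(** Stated over any [numFieldType] because it is used twice, for complex derivatives and for
    derivatives of real functions. *)
Lemma is_derive1_epsP (K : numFieldType) (f : K^o -> K^o) (z d : K^o) :
  is_derive z (1 : K^o) f d <-> forall e : K, 0 < e -> exists2 r : K, 0 < r &
    forall h, `|h| < r -> h != 0 -> `|d - h^-1 * (f (h + z) - f z)| <= e.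
Proof.
have epsP : (h^-1 *: (f (h *: (1 : K^o) + z) - f z)) @[h --> (0 : K)^'] --> d <->
    forall e : K, 0 < e -> exists2 r : K, 0 < r &
      forall h, `|h| < r -> h != 0 -> `|d - h^-1 * (f (h + z) - f z)| <= e.
  split=> [/cvgrPdist_le H e e0|H].
    have /nbhs_normP[r /= r0 rP] := H _ e0; exists r => // h hr h0.
    have := rP h; rewrite /= sub0r normrN => /(_ hr h0).
    by rewrite /GRing.scale/= mulr1.
  apply/cvgrPdist_le => e e0; have [r r0 rP] := H _ e0.
  apply/nbhs_normP; exists r => //= h; rewrite /= sub0r normrN => hr h0.
  by rewrite /GRing.scale/= mulr1; exact: rP.
split=> [[fz fd]|/epsP H].
  by apply/epsP; rewrite -fd; exact: fz.
by apply: DeriveDef; [apply/cvg_ex; exists d|exact: cvg_lim].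
Qed.

Section ComplexDerivative.
Variable R : realType.
Implicit Types (f g : R[i] -> R[i]) (z w d : R[i]).

(** Differentiability without a quotient: tolerances are real and [w = z] is no exception, so the
    chain rule has no degenerate case. *)
Definition cderiv f z d := forall e : R, 0 < e -> exists2 r : R, 0 < r &
  forall w, cabs (w - z) < r ->
    cabs (f w - f z - d * (w - z)) <= e * cabs (w - z).

Let diff_quotientE f z d w : w != z ->
  cabs (d - (w - z)^-1 * (f w - f z)) =
  cabs (f w - f z - d * (w - z)) / cabs (w - z).
Proof.
move=> wz; rewrite -cabsV -cabsM cabsC; congr cabs; field.
by rewrite subr_eq0.
Qed.

Lemma cderivP (f : Cplx R -> Cplx R) (z d : Cplx R) :
  cderiv f z d <-> is_derive z (1 : Cplx R) f d.
Proof.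
split=> [fd|/(@is_derive1_epsP (R[i])) fd].
(* In the order of [R[i]] a positive tolerance is a complex number with zero imaginary part, so its
   real part carries all of it. *)
- apply/(@is_derive1_epsP (R[i])) => e; rewrite ltcE/= => /andP[/eqP Ie Re0].
  have [r r0 rP] := fd _ Re0; exists r%:C%C; first by rewrite ltcR.
  move=> h; rewrite !cabs_norm ltcR lecE/= Ie eqxx/= => hr h0.
  have hz : h + z != z by rewrite -subr_eq0 addrK.
  have := diff_quotientE f d hz; rewrite addrK => ->.
  by rewrite ler_pdivrMr ?cabs_gt0//; have := rP (h + z); rewrite addrK; exact.
- move=> e e0; have [|r] := fd e%:C%C; first by rewrite ltcR.
  rewrite ltcE/= => /andP[/eqP Ir r0] rP; exists (complex.Re r) => // w wr.
  have [->|wz] := eqVneq w z; first by rewrite !subrr mulr0 subr0 cabs0 mulr0.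
  have := rP (w - z); rewrite !cabs_norm ltcE lecR/= Ir eqxx/= wr subr_eq0.
  rewrite subrK => /(_ isT wz); rewrite diff_quotientE//.
  by rewrite ler_pdivrMr ?cabs_gt0 ?subr_eq0.
Qed.

Lemma cderiv_derive1 (f : Cplx R -> Cplx R) (z d : Cplx R) :
  cderiv f z d -> derivable f z 1 /\ derive1 f z = d.
Proof.
move=> /cderivP [fz fd]; split; first exact: fz.
rewrite -fd; exact: (@derive1E (R[i]) (R[i])^o f z).
Qed.

Lemma derivable_cderiv (f : Cplx R -> Cplx R) (z : Cplx R) :
  derivable f z 1 -> cderiv f z (derive1 f z).
Proof.
move=> fz; have fd := @derivableP (R[i]) (R[i])^o (R[i])^o f z 1 fz.
have E := @derive1E (R[i]) (R[i])^o f z.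
exact: (eq_ind _ (cderiv f z) ((cderivP f z _).2 fd) _ (esym E)).
Qed.

Lemma cderiv_local f g z d : (exists2 r : R, 0 < r &
    forall w, cabs (w - z) < r -> f w = g w) -> cderiv f z d -> cderiv g z d.
Proof.
move=> [r r0 fg] fd e e0; have [s s0 sP] := fd _ e0.
exists (Num.min r s) => [|w]; first by rewrite lt_min r0.
rewrite lt_min => /andP[wr ws].
by rewrite -!fg// ?subrr ?cabs0//; exact: sP.
Qed.

Lemma cderiv_lip f z d : cderiv f z d -> exists2 r : R, 0 < r &
  forall w, cabs (w - z) < r -> cabs (f w - f z) <= (1 + cabs d) * cabs (w - z).
Proof.
move=> /(_ _ ltr01)[r r0 rP]; exists r => // w /rP; rewrite mul1r mulrDl mul1r.
rewrite -cabsM -lerBlDr => H; apply: le_trans H; exact: cabs_lerB.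
Qed.

Lemma cderiv_comp f g z d d' :
  cderiv g z d -> cderiv f (g z) d' -> cderiv (f \o g) z (d' * d).
Proof.
move=> gd fd e e0.
have K0 : 0 < 1 + cabs d by rewrite ltr_pwDl ?cabs_ge0.
have K0' : 0 < 1 + cabs d' by rewrite ltr_pwDl ?cabs_ge0.
have [r1 r10 r1P] := cderiv_lip gd.
have [r2 r20 r2P] := fd _ (divr_gt0 (divr_gt0 e0 (ltr0Sn _ 1)) K0).
have [r3 r30 r3P] := gd _ (divr_gt0 (divr_gt0 e0 (ltr0Sn _ 1)) K0').
exists (Num.min r1 (Num.min (r2 / (1 + cabs d)) r3)).
  by rewrite !lt_min r10 r30 divr_gt0.
move=> w; rewrite !lt_min => /and3P[w1 w2 w3] /=.
have Lw := r1P _ w1.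
have := r2P (g w) (le_lt_trans Lw _); rewrite mulrC -ltr_pdivlMr// => /(_ w2) A.
have B := r3P _ w3.
have -> : f (g w) - f (g z) - d' * d * (w - z) =
  (f (g w) - f (g z) - d' * (g w - g z)) + d' * (g w - g z - d * (w - z)).
  ring.
apply: le_trans (cabsD _ _) _; rewrite cabsM.
have -> : e * cabs (w - z) =
  e / 2 / (1 + cabs d) * ((1 + cabs d) * cabs (w - z)) +
  (1 + cabs d') * (e / 2 / (1 + cabs d') * cabs (w - z)).
  by field; rewrite !gt_eqF.
apply: lerD.
  by apply: le_trans A _; rewrite ler_wpM2l// !divr_ge0// ltW.
apply: ler_pM => //; rewrite ?cabs_ge0//.
by rewrite lerDr.
Qed.

Lemma cderivM f g z d d' : cderiv f z d -> cderiv g z d' ->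
  cderiv (fun w => f w * g w) z (d * g z + f z * d').
Proof.
move=> fd gd.
have H := @is_deriveM (R[i]) (R[i])^o f g z 1 d d' ((cderivP f z d).1 fd)
  ((cderivP g z d').1 gd).
have := (cderivP _ _ _).2 H.
by rewrite /GRing.scale/= addrC (mulrC d).
Qed.

Lemma cderivV f z d : f z != 0 -> cderiv f z d ->
  cderiv (fun w => (f w)^-1) z (- d / f z ^+ 2).
Proof.
move=> fz0 /cderivP[fz fd]; apply/(@cderivP (fun w => (f w)^-1)).
apply: DeriveDef; first exact: (@derivableV (R[i]) (Cplx R)).
rewrite (@deriveV (R[i]) (Cplx R))// fd /GRing.scale/=; field.
exact: fz0.
Qed.

Lemma cderivD f g z d d' : cderiv f z d -> cderiv g z d' ->
  cderiv (fun w => f w + g w) z (d + d').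
Proof.
move=> /cderivP fd /cderivP gd; exact/(@cderivP (fun w => f w + g w)).
Qed.

Lemma cderiv_cst c z : cderiv (fun=> c) z 0.
Proof.
by move=> e e0; exists 1 => // w _; rewrite subrr mul0r subr0 cabs0 mulr_ge0 ?cabs_ge0 ?ltW.
Qed.

Lemma cderiv_id z : cderiv id z 1.
Proof.
by move=> e e0; exists 1 => // w _; rewrite mul1r subrr cabs0 mulr_ge0 ?cabs_ge0 ?ltW.
Qed.

Lemma cderivZ c f z d : cderiv f z d -> cderiv (fun w => c * f w) z (c * d).
Proof. by move=> /(cderivM (cderiv_cst c z)); rewrite mul0r add0r. Qed.

Lemma cderivB f g z d d' : cderiv f z d -> cderiv g z d' ->
  cderiv (fun w => f w - g w) z (d - d').
Proof.
move=> fd /(cderivZ (-1)); rewrite mulN1r => /(cderivD fd).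
by apply: cderiv_local; exists 1 => // w _; rewrite mulN1r.
Qed.

Lemma cderiv_scale c f z d : cderiv f (c * z) d ->
  cderiv (fun w => f (c * w)) z (d * c).
Proof.
apply: cderiv_comp.
by have := cderivZ c (cderiv_id z); rewrite mulr1.
Qed.

End ComplexDerivative.

(** * Mean value inequality and continuity along real curves *)

Section RealCurves.
Variable R : realType.
Implicit Types (q : R -> R[i]) (psi : R -> R).

Lemma is_derive_realP psi (x d : R) : is_derive x 1 psi d <->
  forall e : R, 0 < e -> exists2 r : R, 0 < r & forall y, `|y - x| < r ->
    `|psi y - psi x - d * (y - x)| <= e * `|y - x|.
Proof.
have E y : y != x -> `|d - (y - x)^-1 * (psi y - psi x)| =
    `|psi y - psi x - d * (y - x)| / `|y - x|.
  move=> yx; rewrite -normfV -normrM distrC; congr (`|_|); field.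
  by rewrite subr_eq0.
split=> [/(@is_derive1_epsP R) H|H].
  move=> e e0; have [r r0 rP] := H _ e0; exists r => // y yr.
  have [->|yx] := eqVneq y x; first by rewrite !subrr mulr0 subr0 normr0 mulr0.
  have := rP (y - x) yr; rewrite subr_eq0 subrK => /(_ yx); rewrite E//.
  by rewrite ler_pdivrMr ?normr_gt0 ?subr_eq0.
apply/(@is_derive1_epsP R) => e e0; have [r r0 rP] := H _ e0.
exists r => // h hr h0; have := rP (h + x); rewrite addrK => /(_ hr) K.
have hx : h + x != x by rewrite -subr_eq0 addrK.
by have := E _ hx; rewrite addrK => ->; rewrite ler_pdivrMr ?normr_gt0.
Qed.

Lemma is_derive_Re_segment (f : R[i] -> R[i]) (a b c d : R[i]) (t : R) :
  cderiv f (a + t%:C%C * b) d ->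
  is_derive t 1 (fun s : R => complex.Re (c * f (a + s%:C%C * b)))
                (complex.Re (c * (d * b))).
Proof.
move=> fd; apply/is_derive_realP => e e0.
have K0 : 0 < 1 + cabs c * cabs b.
  by rewrite ltr_pwDl ?mulr_ge0 ?cabs_ge0.
have K1 : 0 < 1 + cabs b by rewrite ltr_pwDl ?cabs_ge0.
have [r r0 rP] := fd _ (divr_gt0 e0 K0).
exists (r / (1 + cabs b)) => [|s]; first exact: divr_gt0.
rewrite ltr_pdivlMr// => sr.
have sE : a + s%:C%C * b - (a + t%:C%C * b) = (s - t)%:C%C * b.
  by rewrite rmorphB/=; ring.
have := rP (a + s%:C%C * b); rewrite sE cabsM cabs_real => H.
have {}H : cabs (f (a + s%:C%C * b) - f (a + t%:C%C * b) - d * ((s - t)%:C%C * b))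
    <= e / (1 + cabs c * cabs b) * (`|s - t| * cabs b).
  by apply: H; apply: le_lt_trans sr; rewrite ler_wpM2l// lerDr.
rewrite (_ : _ - _ - _ = complex.Re (c * (f (a + s%:C%C * b) -
    f (a + t%:C%C * b) - d * ((s - t)%:C%C * b)))); last first.
  have H2 (A B : R[i]) (x : R) : complex.Re (c * (A - B - d * (x%:C%C * b))) =
      complex.Re (c * A) - complex.Re (c * B) - complex.Re (c * (d * b)) * x.
    have -> : c * (A - B - d * (x%:C%C * b)) = c * A - c * B - c * (d * b) * x%:C%C.
      by ring.
    by rewrite raddfB/= raddfB/= [complex.Re (_ * x%:C%C)]cReM /= mulr0 subr0.
  by rewrite H2.
apply: le_trans (Re_cabs _) _; rewrite cabsM.
apply: (@le_trans _ _ (e * `|s - t| * ((cabs c * cabs b) / (1 + cabs c * cabs b)))).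
  rewrite [leRHS](_ : _ = cabs c * (e / (1 + cabs c * cabs b) * (`|s - t| * cabs b))).
    by rewrite ler_wpM2l ?cabs_ge0.
  by field; rewrite gt_eqF.
rewrite ler_piMr ?mulr_ge0//; first exact: ltW.
by rewrite ler_pdivrMr// mul1r lerDr.
Qed.

(** With [c] rotating [f b - f a] onto its modulus, this is the real mean value theorem for
    [B - Re (c f)] along the segment, so [df] may be discontinuous. The majorant [B] is left free
    for the radial estimate, where it is a power of the distance to the circle. *)
Lemma cmean_value (f df : R[i] -> R[i]) (a b : R[i]) (B dB : R -> R) :
  (forall t : R, 0 <= t <= 1 -> cderiv f (a + t%:C%C * (b - a)) (df (a + t%:C%C * (b - a)))) ->
  (forall t : R, 0 <= t <= 1 -> is_derive t 1 B (dB t)) ->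
  (forall t : R, 0 <= t <= 1 -> cabs (df (a + t%:C%C * (b - a)) * (b - a)) <= dB t) ->
  cabs (f b - f a) <= B 1 - B 0.
Proof.
move=> fd Bd dfB; have [c c1 cE] := unimodular_rotation (f b - f a).
pose psi := B - (fun t : R => complex.Re (c * f (a + t%:C%C * (b - a)))).
pose dpsi (t : R) := dB t - complex.Re (c * (df (a + t%:C%C * (b - a)) * (b - a))).
have psid (t : R) : 0 <= t <= 1 -> is_derive t 1 psi (dpsi t).
  move=> t01; apply: is_deriveB; first exact: Bd.
  exact/is_derive_Re_segment/fd.
have [||x /[!in_itv]/= x01] := @MVT_segment R psi dpsi 0 1 ler01.
- by move=> x /[!in_itv]/= /andP[x0 x1]; apply: psid; rewrite !ltW.
- apply: derivable_within_continuous => x /[!in_itv]/= x01.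
  by have [] := psid _ x01.
rewrite /psi !fctE/= rmorph0 rmorph1 mul0r addr0 mul1r subrKC subr0 mulr1.
move=> E; rewrite -subr_ge0 -cE mulrBr raddfB/=.
rewrite (_ : _ - _ = dpsi x); last by rewrite -E; ring.
by rewrite subr_ge0; apply: le_trans (Re_rotation_le _ c1) (dfB _ x01).
Qed.

Lemma cmean_value_lip (f df : R[i] -> R[i]) (a b : R[i]) (M : R) :
  (forall t : R, 0 <= t <= 1 -> cderiv f (a + t%:C%C * (b - a)) (df (a + t%:C%C * (b - a)))) ->
  (forall t : R, 0 <= t <= 1 -> cabs (df (a + t%:C%C * (b - a))) <= M) ->
  cabs (f b - f a) <= M * cabs (b - a).
Proof.
move=> fd dfM.
have := @cmean_value f df a b (fun t => M * cabs (b - a) * t) (fun=> M * cabs (b - a)).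
rewrite mulr1 mulr0 subr0; apply=> //.
  move=> t _; have := @is_deriveZ R R R id (M * cabs (b - a)) t 1 1 (is_derive_id _ _).
  by rewrite /GRing.scale/= mulr1.
by move=> t t01; rewrite cabsM ler_wpM2r ?cabs_ge0 ?dfM.
Qed.

Definition ccont q (t : R) := forall e : R, 0 < e -> exists2 r : R, 0 < r &
  forall s, `|s - t| < r -> cabs (q s - q t) <= e.

Lemma ccont_Re q t : ccont q t -> {for t, continuous (fun s => complex.Re (q s))}.
Proof.
move=> qt; apply/cvgrPdist_le => e e0; have [r r0 rP] := qt _ e0.
apply/nbhs_ballP; exists r => // s; rewrite /ball/= distrC => /rP H.
by rewrite -raddfB; apply: le_trans (Re_cabs _) _; rewrite cabsC.
Qed.

Lemma ccont_Im q t : ccont q t -> {for t, continuous (fun s => complex.Im (q s))}.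
Proof.
move=> qt; apply/cvgrPdist_le => e e0; have [r r0 rP] := qt _ e0.
apply/nbhs_ballP; exists r => // s; rewrite /ball/= distrC => /rP H.
by rewrite -raddfB; apply: le_trans (Im_cabs _) _; rewrite cabsC.
Qed.

Lemma ccont_affine q (c l t : R) :
  ccont q (c + l * t) -> ccont (fun s => q (c + l * s)) t.
Proof.
move=> H e e0; have [r r0 rP] := H _ e0.
have l0 : 0 < 1 + `|l| by rewrite ltr_pwDl.
exists (r / (1 + `|l|)) => [|s]; first exact: divr_gt0.
rewrite ltr_pdivlMr// => sr; apply: rP.
rewrite (_ : _ - _ = (s - t) * l); last by ring.
by rewrite normrM; apply: le_lt_trans sr; rewrite ler_wpM2l// lerDr.
Qed.

Lemma cderiv_ccont (f : R[i] -> R[i]) (q : R -> R[i]) t d :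
  cderiv f (q t) d -> ccont q t -> ccont (f \o q) t.
Proof.
move=> /cderiv_lip[r r0 rP] qt e e0.
have K0 : 0 < 1 + cabs d by rewrite ltr_pwDl ?cabs_ge0.
have m0 : 0 < Num.min (r / 2) (e / (1 + cabs d)) by rewrite lt_min !divr_gt0.
have [s s0 sP] := qt _ m0; exists s => // y /sP; rewrite le_min => /andP[yr ye].
have : cabs (q y - q t) < r.
  by apply: le_lt_trans yr _; rewrite ltr_pdivrMr// ltr_pMr// ltr1n.
by move=> /rP /le_trans; apply; rewrite mulrC -ler_pdivlMr.
Qed.

Lemma ccontM (p q : R -> R[i]) t :
  ccont p t -> ccont q t -> ccont (fun s => p s * q s) t.
Proof.
move=> pt qt e e0.
have Kp : 0 < 1 + cabs (p t) by rewrite ltr_pwDl ?cabs_ge0.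
have Kq : 0 < 1 + cabs (q t) by rewrite ltr_pwDl ?cabs_ge0.
have m0 : 0 < Num.min 1 (e / 2 / (1 + cabs (q t))) by rewrite lt_min ltr01 !divr_gt0.
have m1 : 0 < e / 2 / (1 + cabs (p t)) by rewrite !divr_gt0.
have [r r0 rP] := pt _ m0; have [s s0 sP] := qt _ m1.
exists (Num.min r s) => [|y]; first by rewrite lt_min r0.
rewrite lt_min => /andP[/rP + /sP H2]; rewrite le_min => /andP[H1 H3].
rewrite (_ : _ - _ = p y * (q y - q t) + (p y - p t) * q t); last by ring.
apply: le_trans (cabsD _ _) _; rewrite !cabsM.
have py : cabs (p y) <= 1 + cabs (p t).
  by rewrite -lerBlDr; apply: le_trans (cabs_lerB _ _) _.
rewrite (splitr e); apply: lerD.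
  rewrite [leRHS](_ : _ = (1 + cabs (p t)) * (e / 2 / (1 + cabs (p t)))).
    by rewrite ler_pM ?cabs_ge0.
  by field; rewrite gt_eqF.
rewrite [leRHS](_ : _ = e / 2 / (1 + cabs (q t)) * (1 + cabs (q t))).
  by rewrite ler_pM ?cabs_ge0// lerDr.
by field; rewrite gt_eqF.
Qed.

Lemma ccont_real (t : R) : ccont (fun s => s%:C%C) t.
Proof.
by move=> e e0; exists e => // s /ltW; rewrite -rmorphB/= cabs_real.
Qed.

Lemma ccont_cst (c : R[i]) t : ccont (fun=> c) t.
Proof. by move=> e e0; exists 1 => // s _; rewrite subrr cabs0 ltW. Qed.

Lemma ccontD (p q : R -> R[i]) t :
  ccont p t -> ccont q t -> ccont (fun s => p s + q s) t.
Proof.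
move=> pt qt e e0; have e2 : 0 < e / 2 by rewrite divr_gt0.
have [r r0 rP] := pt _ e2; have [s s0 sP] := qt _ e2.
exists (Num.min r s) => [|y]; first by rewrite lt_min r0.
rewrite lt_min => /andP[/rP H1 /sP H2].
rewrite (_ : _ - _ = (p y - p t) + (q y - q t)); last by ring.
by apply: le_trans (cabsD _ _) _; rewrite (splitr e) lerD.
Qed.

Lemma ccont_eq (p q : R -> R[i]) t : (exists2 r : R, 0 < r &
  forall s, `|s - t| < r -> p s = q s) -> ccont p t -> ccont q t.
Proof.
move=> [r r0 rP] pt e e0; have [s s0 sP] := pt _ e0.
exists (Num.min r s) => [|y]; first by rewrite lt_min r0.
rewrite lt_min => /andP[yr ys]; rewrite -!rP ?subrr ?normr0//.
exact: sP.
Qed.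

End RealCurves.

(** * Complex integrals over the unit interval *)

Section SegmentIntegral.
Variable R : realType.
Notation mu := (@lebesgue_measure R).
Implicit Types (p q : R -> R[i]).

Definition cintegrable q :=
  mu.-integrable `[0, 1] (EFin \o (fun t => complex.Re (q t))) /\
  mu.-integrable `[0, 1] (EFin \o (fun t => complex.Im (q t))).

Let within01 (f : R -> R) : (forall t, 0 <= t <= 1 -> {for t, continuous f}) ->
  {within `[0, 1], continuous f}.
Proof.
move=> fc; apply: continuous_in_subspaceT => t.
by rewrite inE/= in_itv/= => /fc.
Qed.

Lemma ccont_integrable q : (forall t, 0 <= t <= 1 -> ccont q t) -> cintegrable q.
Proof.
move=> qc; split; apply: continuous_compact_integrable;
  by [exact: segment_compact|apply: within01 => t /qc/ccont_Re
     |apply: within01 => t /qc/ccont_Im].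
Qed.

Lemma cintegrableD p q : cintegrable p -> cintegrable q ->
  cintegrable (fun t => p t + q t).
Proof.
move=> [p1 p2] [q1 q2]; split.
  by apply: eq_integrable (integrableD _ p1 q1) => // t _ /=; rewrite raddfD.
by apply: eq_integrable (integrableD _ p2 q2) => // t _ /=; rewrite raddfD.
Qed.

Lemma cint01D p q : cintegrable p -> cintegrable q ->
  cint01 (fun t => p t + q t) = cint01 p + cint01 q.
Proof.
move=> [p1 p2] [q1 q2]; apply: eq_ReIm; rewrite raddfD/=.
  rewrite -RintegralD//; apply: eq_Rintegral => t _; exact: raddfD.
rewrite -RintegralD//; apply: eq_Rintegral => t _; exact: raddfD.
Qed.

Let integrable_lin (f g : R -> R) (a b : R) :
  mu.-integrable `[0, 1] (EFin \o f) -> mu.-integrable `[0, 1] (EFin \o g) ->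
  mu.-integrable `[0, 1] (EFin \o (fun t => a * f t + b * g t)).
Proof.
move=> fi gi.
have fa := @integrableZl _ _ _ mu _ (measurable_itv _) a _ fi.
have ga := @integrableZl _ _ _ mu _ (measurable_itv _) b _ gi.
exact: (@integrableD _ _ _ mu _ (measurable_itv _) _ _ fa ga).
Qed.

Let Rintegral_lin (f g : R -> R) (a b : R) :
  mu.-integrable `[0, 1] (EFin \o f) -> mu.-integrable `[0, 1] (EFin \o g) ->
  Rintegral mu `[0, 1] (fun t => a * f t + b * g t) =
  a * Rintegral mu `[0, 1] f + b * Rintegral mu `[0, 1] g.
Proof.
move=> fi gi; rewrite RintegralD//; first by rewrite !RintegralZl.
- exact: (@integrableZl _ _ _ mu _ (measurable_itv _) a _ fi).
- exact: (@integrableZl _ _ _ mu _ (measurable_itv _) b _ gi).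
Qed.

Lemma cintegrableZ (c : R[i]) q : cintegrable q -> cintegrable (fun t => c * q t).
Proof.
move=> [q1 q2]; split.
  apply: eq_integrable (integrable_lin (complex.Re c) (- complex.Im c) q1 q2) => //.
  move=> t _ /=. by rewrite cReM mulNr.
apply: eq_integrable (integrable_lin (complex.Re c) (complex.Im c) q2 q1) => //.
by move=> t _ /=; rewrite cImM.
Qed.

Lemma cint01Z (c : R[i]) q : cintegrable q ->
  cint01 (fun t => c * q t) = c * cint01 q.
Proof.
move=> [q1 q2]; apply: eq_ReIm; rewrite ?cReM ?cImM/=.
  rewrite -mulNr -Rintegral_lin//.
  by apply: eq_Rintegral => t _; rewrite cReM mulNr.
rewrite -Rintegral_lin//.
by apply: eq_Rintegral => t _; rewrite cImM.
Qed.

Let Rintegral_cst01 (M : R) : Rintegral mu `[0, 1] (fun=> M) = M.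
Proof.
by rewrite Rintegral_cst//= lebesgue_measure_itv/= lte_fin ltr01 oppr0 addr0 mulr1.
Qed.

Lemma cint01_cst (c : R[i]) : cint01 (fun=> c) = c.
Proof. by apply: eq_ReIm; rewrite /= Rintegral_cst01. Qed.

Lemma cint01_le q (M : R) : cintegrable q ->
  (forall t, 0 <= t <= 1 -> cabs (q t) <= M) -> cabs (cint01 q) <= M.
Proof.
move=> qi qM; have [c c1 <-] := unimodular_rotation (cint01 q).
have [cq _] := cintegrableZ c qi.
rewrite -cint01Z//= -[leRHS]Rintegral_cst01; apply: le_Rintegral => //.
  apply: continuous_compact_integrable; first exact: segment_compact.
  by apply: within01 => t _; exact: cvg_cst.
move=> t /=; rewrite in_itv/= => t01.
exact: le_trans (Re_rotation_le _ c1) (qM _ t01).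
Qed.

(* The value at [0] is irrelevant: the integrands of the Cesaro operator carry
   there the junk value of a division by zero. *)
Lemma eq_cint01 p q : cintegrable q -> (forall t, 0 < t <= 1 -> p t = q t) ->
  cint01 p = cint01 q.
Proof.
move=> [q1 q2] pq.
have eqI (f g : R -> R) : (forall t, 0 < t <= 1 -> f t = g t) ->
    mu.-integrable `[0, 1] (EFin \o g) ->
    Rintegral mu `[0, 1] f = Rintegral mu `[0, 1] g.
  move=> fg gi.
  have gi' : mu.-integrable `]0, 1] (EFin \o g).
    by apply: integrableS gi => //; apply: subset_itvr; rewrite bnd_simp.
  have fi' : mu.-integrable `]0, 1] (EFin \o f).
    apply: eq_integrable gi' => //= t; rewrite inE/= in_itv/= => t01.
    by rewrite fg.
  rewrite -!Rintegral_itv_obnd_cbnd//.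
  by apply: eq_Rintegral => t; rewrite inE/= in_itv/= => /fg.
by apply: eq_ReIm => /=; apply: eqI => // t /pq ->.
Qed.

End SegmentIntegral.

(** * Dominated convergence, differentiation under the integral, cutting the unit interval *)

Section DifferentiationUnderIntegral.
Variable R : realType.
Notation mu := (@lebesgue_measure R).
Implicit Types (p q : R -> R[i]).

Let Rintegral_dct (e : nat -> R -> R) (d : R -> R) (L : R) :
  (forall n, mu.-integrable `[0, 1] (EFin \o e n)) ->
  (forall t, 0 <= t <= 1 -> e n t @[n --> \oo] --> d t) ->
  (forall n t, 0 <= t <= 1 -> `|e n t| <= L) ->
  mu.-integrable `[0, 1] (EFin \o d) /\
  Rintegral mu `[0, 1] (e n) @[n --> \oo] --> Rintegral mu `[0, 1] d.
Proof.
move=> ei ed eL.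
have m01 : measurable (`[0%R, 1%R]%classic : set (measurableTypeR R)).
  exact: measurable_itv.
have me n := measurable_int mu (ei n).
have ed' (t : R) : (`[0%R, 1%R]%classic : set R) t ->
    (EFin \o e n) t @[n --> \oo] --> (EFin \o d) t.
  rewrite /= in_itv/= => /ed H; apply: cvg_EFin; last exact: H.
  exact: nearW.
have md := emeasurable_fun_cvg _ _ me ed'.
have iL : mu.-integrable `[0, 1] (fun=> L%:E).
  apply: (@continuous_compact_integrable _ (fun=> L)); first exact: segment_compact.
  by move=> x; exact: cvg_cst.
have eL' n (t : R) : (`[0%R, 1%R]%classic : set R) t ->
    (`|(EFin \o e n) t| <= L%:E)%E.
  by rewrite /= in_itv/= lee_fin => /(eL n).
have [di _ lim] := @dominated_convergence _ _ _ mu _ m01 _ _ _ me md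
  (aeW mu ed') iL (aeW mu (fun t n => eL' n t)).
split=> //; apply: fine_cvg; rewrite fineK//; exact: integrable_fin_num.
Qed.

(** Nothing is assumed of the limit [d]: its measurability, hence integrability, comes from the
    convergence. This matters because [d] will be a derivative that is only known to be bounded. *)
Lemma cint01_dominated (e : nat -> R -> R[i]) (d : R -> R[i]) (L : R) :
  (forall n, cintegrable (e n)) ->
  (forall t, 0 <= t <= 1 -> forall eps : R, 0 < eps ->
     \forall n \near \oo, cabs (e n t - d t) <= eps) ->
  (forall n t, 0 <= t <= 1 -> cabs (e n t) <= L) ->
  forall eps : R, 0 < eps ->
    \forall n \near \oo, cabs (cint01 (e n) - cint01 d) <= eps.
Proof.
move=> ei ed eL eps eps0.
have [|||_ /cvgrPdist_le H1] :=
  @Rintegral_dct (fun n t => complex.Re (e n t)) (fun t => complex.Re (d t)) L.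
- by move=> n; have [] := ei n.
- move=> t t01; apply/cvgrPdist_le => r r0; have := ed _ t01 _ r0.
  apply: filterS => n; apply: le_trans; rewrite cabsC -raddfB; exact: Re_cabs.
- by move=> n t /(eL n); apply: le_trans; exact: Re_cabs.
have [|||_ /cvgrPdist_le H2] :=
  @Rintegral_dct (fun n t => complex.Im (e n t)) (fun t => complex.Im (d t)) L.
- by move=> n; have [] := ei n.
- move=> t t01; apply/cvgrPdist_le => r r0; have := ed _ t01 _ r0.
  apply: filterS => n; apply: le_trans; rewrite cabsC -raddfB; exact: Im_cabs.
- by move=> n t /(eL n); apply: le_trans; exact: Im_cabs.
have e2 : 0 < eps / 2 by rewrite divr_gt0.
move: (H1 _ e2) (H2 _ e2); apply: filterS2 => n h1 h2.
rewrite cabsC; apply: le_trans (cabs_ReIm _) _.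
by rewrite (splitr eps) !raddfB lerD.
Qed.

(** The difference quotients in [z] converge pointwise to [d] and are dominated by the Lipschitz
    constant [L]. *)
Lemma cderiv_cint01 (k : R -> R[i] -> R[i]) (d : R -> R[i]) (z0 : R[i]) (r L : R) :
  0 < r ->
  (forall z, cabs (z - z0) < r -> cintegrable (fun t => k t z)) ->
  (forall t, 0 <= t <= 1 -> cderiv (k t) z0 (d t)) ->
  (forall t z, 0 <= t <= 1 -> cabs (z - z0) < r ->
     cabs (k t z - k t z0) <= L * cabs (z - z0)) ->
  cderiv (fun z => cint01 (fun t => k t z)) z0 (cint01 d).
Proof.
move=> r0 ki kd kL e e0; apply: contrapT => H.
(* Dominated convergence speaks of sequences, so a failure of differentiability is first turned into
   points [w n] tending to [z0] at which the estimate fails. *)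
have {}H (n : nat) : exists w, cabs (w - z0) < Num.min r n.+1%:R^-1 /\
    ~ (cabs (cint01 (fun t => k t w) - cint01 (fun t => k t z0)
         - cint01 d * (w - z0)) <= e * cabs (w - z0)).
  apply: contrapT => /forallNP N; apply: H.
  exists (Num.min r n.+1%:R^-1); first by rewrite lt_min r0 invr_gt0 ltr0Sn.
  by move=> w wn; apply: contrapT => X; exact: N w (conj wn X).
have [w wP] := choice H.
have wr n : cabs (w n - z0) < r by have [] := wP n; rewrite lt_min => /andP[].
have wn n : cabs (w n - z0) < n.+1%:R^-1 by have [] := wP n; rewrite lt_min => /andP[].
have w0 n : w n - z0 != 0.
  apply/eqP => wz; have [_] := wP n; apply.
  move/eqP: (wz); rewrite subr_eq0 => /eqP ->.
  by rewrite !subrr mulr0 subr0 cabs0 mulr0.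
have z0r : cabs (z0 - z0) < r by rewrite subrr cabs0.
pose q n t := (w n - z0)^-1 * (k t (w n) + (-1) * k t z0).
have qi n : cintegrable (q n).
  by apply/cintegrableZ/cintegrableD; [exact: ki|apply: cintegrableZ; exact: ki].
have qE n : cint01 (q n) = (w n - z0)^-1 *
    (cint01 (fun t => k t (w n)) - cint01 (fun t => k t z0)).
  rewrite cint01Z; last first.
    by apply: cintegrableD; [exact: ki|apply: cintegrableZ; exact: ki].
  rewrite cint01D; [|exact: ki|by apply: cintegrableZ; exact: ki].
  by rewrite cint01Z ?mulN1r//; exact: ki.
have [] := @cint01_dominated q d L qi _ _ e e0.
- move=> t t01 s s0; have [x x0 xP] := kd t t01 _ s0.
  have /cvgrPdist_lt/(_ _ x0) := @cvg_harmonic R.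
  apply: filterS => n; rewrite sub0r normrN ger0_norm ?invr_ge0// => nx.
  have := xP _ (lt_trans (wn n) nx).
  rewrite -ler_pdivrMr ?cabs_gt0// -cabsV -cabsM => X; apply: le_trans X.
  by rewrite le_eqVlt; apply/orP; left; apply/eqP; congr cabs; rewrite /q; field.
- move=> n t t01; rewrite /q mulN1r cabsM cabsV ler_pdivrMl ?cabs_gt0//.
  by rewrite mulrC; exact: kL.
move=> N _ /(_ N (leqnn N)) H2; have [_] := wP N; apply.
rewrite -ler_pdivrMr ?cabs_gt0// -cabsV -cabsM; apply: le_trans H2.
rewrite qE le_eqVlt; apply/orP; left; apply/eqP; congr cabs.
by field.
Qed.

Let Rintegral_affine (f : R -> R) (c l : R) : 0 < l ->
  (forall t, c <= t <= c + l -> {for t, continuous f}) ->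
  Rintegral mu `[c, c + l] f = Rintegral mu `[0, 1] (fun t => l * f (c + l * t)).
Proof.
move=> l0 fc; pose F (t : R) := c + l * t.
have Fd (t : R) : is_derive t 1 F l.
  have H := @is_deriveZ R R R id l t 1 1 (is_derive_id _ _).
  have := @is_deriveD R R R (fun=> c) (l *: id) t 1 0 _ (is_derive_cst _ _ _) H.
  by rewrite add0r /GRing.scale/= mulr1.
have F'E : F^`()%classic = fun=> l.
  by apply/funext => t; rewrite derive1E derive_val.
have Fc (t : R) : {for t, continuous F}.
  by apply/differentiable_continuous/derivable1_diffP; have [] := Fd t.
have := @integration_by_substitution_increasing R F f 0 1 ler01.
rewrite F'E /F mulr0 addr0 mulr1 => E.
rewrite /Rintegral E//.
- by congr fine; apply: eq_integral => t _ /=; rewrite fctE/= mulrC.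
- by move=> x y _ _ xy; rewrite ltrD2l ltr_pM2l.
- by move=> x _; exact: cvg_cst.
- by apply/cvg_ex; exists l; exact: cvg_cst.
- by apply/cvg_ex; exists l; exact: cvg_cst.
- split.
  + by move=> x _; have [] := Fd x.
  + by have := cvg_at_right_filter (Fc 0).
  + by have := cvg_at_left_filter (Fc 1).
- apply: continuous_in_subspaceT => t; rewrite inE/= in_itv/=; exact: fc.
Qed.

(** Both pieces are rescaled to the unit interval, so that no other interval of integration is
    needed for rays and circles. *)
Lemma cint01_split q (s : R) : 0 < s < 1 ->
  (forall t, 0 <= t <= 1 -> ccont q t) ->
  cint01 q = s%:C%C * cint01 (fun t => q (s * t)) +
             (1 - s)%:C%C * cint01 (fun t => q (s + (1 - s) * t)).
Proof.
move=> /andP[s0 s1] qc.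
have s1' : 0 < 1 - s by rewrite subr_gt0.
have qi1 : cintegrable (fun t => q (s * t)).
  apply: ccont_integrable => t /andP[t0 t1].
  rewrite (_ : (fun t => q (s * t)) = (fun t => q (0 + s * t))); last first.
    by apply/funext => x; rewrite add0r.
  by apply: ccont_affine; rewrite add0r; apply: qc; rewrite mulr_ge0 ?mulr_ile1// ltW.
have qi2 : cintegrable (fun t => q (s + (1 - s) * t)).
  apply: ccont_integrable => t /andP[t0 t1].
  apply: ccont_affine; apply: qc; apply/andP; split; nra.
rewrite -!cint01Z//.
have Rsplit (f : R -> R) : (forall t, 0 <= t <= 1 -> {for t, continuous f}) ->
    Rintegral mu `[0, 1] f = Rintegral mu `[0, 1] (fun t => s * f (s * t)) +
      Rintegral mu `[0, 1] (fun t => (1 - s) * f (s + (1 - s) * t)).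
  move=> fc.
  have fi : mu.-integrable `[0, 1] (EFin \o f).
    apply: continuous_compact_integrable; first exact: segment_compact.
    by apply: continuous_in_subspaceT => t; rewrite inE/= in_itv/=; exact: fc.
  rewrite -Rintegral_affine//; last first.
    by rewrite subrKC => t /andP[t0 t1]; apply: fc; rewrite t1 (le_trans (ltW s0)).
  have -> : Rintegral mu `[0, 1] (fun t => s * f (s * t)) =
      Rintegral mu `[0, 1] (fun t => s * f (0 + s * t)).
    by apply: eq_Rintegral => t _; rewrite add0r.
  rewrite -Rintegral_affine// ?add0r; last first.
    by move=> t /andP[t0 t1]; apply: fc; rewrite t0 (le_trans t1)// ltW.
  rewrite subrKC; apply/eqP; rewrite addrC -subr_eq; apply/eqP.
  rewrite (@Rintegral_itvB _ f (BLeft 0) (BRight 1) s) ?bnd_simp ?ltW//.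
  rewrite Rintegral_itv_obnd_cbnd//.
  by apply: integrableS fi => //; apply: subset_itvr; rewrite bnd_simp ltW.
apply: eq_ReIm; rewrite raddfD/=.
  rewrite (Rsplit (fun t => complex.Re (q t))); last by move=> t /qc/ccont_Re.
  by congr (_ + _); apply: eq_Rintegral => t _; rewrite cReM/= mul0r subr0.
rewrite (Rsplit (fun t => complex.Im (q t))); last by move=> t /qc/ccont_Im.
by congr (_ + _); apply: eq_Rintegral => t _; rewrite cImM/= mul0r addr0.
Qed.

End DifferentiationUnderIntegral.

(** * Exponential, logarithm and the weight (1 - w)^-a *)

Section ExpLog.
Variable R : realType.
Implicit Types (z w u : R[i]).

Definition cexp z : R[i] :=
  Complex (expR (complex.Re z) * cos (complex.Im z))
          (expR (complex.Re z) * sin (complex.Im z)).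

(** The principal logarithm on the right half-plane, which contains every [1 - w] with [|w| < 1].
    There [atan (Im u / Re u)] is also the branch taken by [carg]. *)
Definition clog u : R[i] :=
  Complex (ln (cabs u)) (atan (complex.Im u / complex.Re u)).

Lemma cexp0 : cexp 0 = 1.
Proof. by apply: eq_ReIm; rewrite /= expR0 ?cos0 ?sin0 ?mulr1 ?mulr0. Qed.

Lemma cexpD z w : cexp (z + w) = cexp z * cexp w.
Proof.
case: z w => [a b] [c d]; apply: eq_ReIm; rewrite ?cReM ?cImM /= expRD ?cosD ?sinD.
  ring.
ring.
Qed.

Lemma cabs_cexp z : cabs (cexp z) = expR (complex.Re z).
Proof.
by rewrite /cabs/= !exprMn -mulrDr cos2Dsin2 mulr1 sqrtr_sqr ger0_norm ?expR_ge0.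
Qed.

Let cderiv_cexp0 : cderiv cexp 0 1.
Proof.
move=> e e0.
(* The errors of the real and imaginary parts will be at most [4 d |w|] and [5 d |w|], so
   [d <= e / 10] suffices; [d <= 1] gives [|exp (Re w)| <= 3]. *)
have e9 : 0 < Num.min 1 (e / 10) by rewrite lt_min ltr01 divr_gt0.
have e9' : Num.min 1 (e / 10) <= e / 10 by rewrite ge_min lexx orbT.
have e9'' : Num.min 1 (e / 10) <= 1 by rewrite ge_min lexx.
move: (Num.min _ _) e9 e9' e9'' => d d0 de d1.
have /is_derive_realP/(_ _ d0)[r1 r10 r1P] := is_derive_expR (0 : R).
have /is_derive_realP/(_ _ d0)[r2 r20 r2P] := is_derive_cos (0 : R).
have /is_derive_realP/(_ _ d0)[r3 r30 r3P] := is_derive_sin (0 : R).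
exists (Num.min d (Num.min r1 (Num.min r2 r3))).
  by rewrite !lt_min d0 r10 r20 r30.
move=> w; rewrite subr0 !lt_min => /and4P[wd w1 w2 w3].
have aw := Re_cabs w; have bw := Im_cabs w.
move: (r1P (complex.Re w)) (r2P (complex.Im w)) (r3P (complex.Im w)).
rewrite !subr0 expR0 cos0 sin0 oppr0 mul0r mul1r addr0 !subr0 mul1r.
move=> /(_ (le_lt_trans aw w1)) H1 /(_ (le_lt_trans bw w2)) H2 /(_ (le_lt_trans bw w3)) H3.
rewrite cexp0 mul1r; apply: le_trans (cabs_ReIm _) _.
rewrite (_ : complex.Re (cexp w - 1 - w) = expR (complex.Re w) *
  cos (complex.Im w) - 1 - complex.Re w); last by rewrite !(@raddfB _ _ (@complex.Re R)).
rewrite (_ : complex.Im (cexp w - 1 - w) = expR (complex.Re w) *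
  sin (complex.Im w) - complex.Im w); last by rewrite !(@raddfB _ _ (@complex.Im R)) /= subr0.
move: aw bw wd H1 H2 H3 (cabs_ge0 w).
move: (cabs w) (complex.Re w) (complex.Im w) => m a b.
move: (expR a) (cos b) (sin b) => E C S.
move=> aw bw wd H1 H2 H3 m0.
have H1' : `|E - 1 - a| <= d * m by apply: le_trans H1 _; rewrite ler_wpM2l// ltW.
have H2' : `|C - 1| <= d * m by apply: le_trans H2 _; rewrite ler_wpM2l// ltW.
have H3' : `|S - b| <= d * m by apply: le_trans H3 _; rewrite ler_wpM2l// ltW.
have dm : d * m <= d by rewrite ler_piMr ?(ltW d0)// (le_trans (ltW wd)).
have E1 : `|E - 1| <= 2 * m.
  rewrite (_ : E - 1 = (E - 1 - a) + a); last by ring.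
  apply: le_trans (ler_normD _ _) _; rewrite mulrDl mul1r lerD//.
  by apply: le_trans H1' _; rewrite ler_piMl.
have EC : `|E| <= 3.
  rewrite (_ : E = (E - 1) + 1); last by ring.
  apply: le_trans (ler_normD _ _) _; rewrite normr1.
  by have := le_trans (ltW wd) d1; lra.
have Sm : `|S| <= 2 * m.
  rewrite (_ : S = (S - b) + b); last by ring.
  apply: le_trans (ler_normD _ _) _; rewrite mulrDl mul1r lerD//.
  by apply: le_trans H3' _; rewrite ler_piMl.
have A1 : `|E * C - 1 - a| <= 4 * (d * m).
  rewrite (_ : _ - _ - _ = E * (C - 1) + (E - 1 - a)); last by ring.
  apply: le_trans (ler_normD _ _) _; rewrite normrM.
  have : `|E| * `|C - 1| <= 3 * (d * m) by rewrite ler_pM.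
  lra.
have A2 : `|E * S - b| <= 5 * (d * m).
  rewrite (_ : _ - _ = (E - 1) * S + (S - b)); last by ring.
  apply: le_trans (ler_normD _ _) _; rewrite normrM.
  have : `|E - 1| * `|S| <= (2 * m) * (2 * m) by rewrite ler_pM.
  have : m * m <= d * m by rewrite ler_wpM2r// ltW.
  have -> : 2 * m * (2 * m) = 4 * (m * m) by ring.
  lra.
have : d * m <= e / 10 * m by rewrite ler_wpM2r.
have : 0 <= e * m := mulr_ge0 (ltW e0) m0.
lra.
Qed.

Lemma cderiv_cexp z : cderiv cexp z (cexp z).
Proof.
move=> e e0; have K0 : 0 < cabs (cexp z) by rewrite cabs_cexp expR_gt0.
have [r r0 rP] := cderiv_cexp0 (divr_gt0 e0 K0); exists r => // w wr.
have := rP (w - z); rewrite subr0 cexp0 mul1r => /(_ wr) H.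
rewrite (_ : _ - _ - _ = cexp z * (cexp (w - z) - 1 - (w - z))); last first.
  have -> : cexp w = cexp z * cexp (w - z) by rewrite -cexpD addrC subrK.
  ring.
rewrite cabsM mulrC -ler_pdivlMr//; apply: le_trans H _.
by rewrite mulrAC.
Qed.

Lemma cabs_gt0_Re u : 0 < complex.Re u -> 0 < cabs u.
Proof. by move=> u0; apply: lt_le_trans u0 (le_trans (ler_norm _) (Re_cabs u)). Qed.

Lemma cexp_clog u : 0 < complex.Re u -> cexp (clog u) = u.
Proof.
move=> u0; have cu := cabs_gt0_Re u0.
have ca : cos (atan (complex.Im u / complex.Re u)) = complex.Re u / cabs u.
  rewrite cos_atan -[RHS]invf_div; congr (_^-1).
  have -> : 1 + (complex.Im u / complex.Re u) ^+ 2 = (cabs u / complex.Re u) ^+ 2.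
    rewrite !expr_div_n sqr_sqrtr ?addr_ge0 ?sqr_ge0// mulrDl divff//.
    by rewrite expf_neq0// gt_eqF.
  by rewrite sqrtr_sqr ger0_norm// divr_ge0 ?cabs_ge0 ?ltW.
have sa : sin (atan (complex.Im u / complex.Re u)) = complex.Im u / cabs u.
  have := atanK (complex.Im u / complex.Re u); rewrite /tan ca => /eqP.
  rewrite eqr_div; last 2 first.
  - by rewrite mulf_neq0 ?invr_eq0 ?gt_eqF.
  - by rewrite gt_eqF.
  move=> /eqP H; apply: (mulIf (lt0r_neq0 u0)); rewrite H.
  by field; rewrite gt_eqF.
apply: eq_ReIm; rewrite /= ?ca ?sa lnK ?posrE//; field; by rewrite gt_eqF.
Qed.

Lemma clog_cont u : 0 < complex.Re u -> forall e : R, 0 < e ->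
  exists2 r : R, 0 < r & forall w, cabs (w - u) < r -> cabs (clog w - clog u) <= e.
Proof.
move=> u0 e e0; have cu := cabs_gt0_Re u0.
have e2 : 0 < e / 2 by rewrite divr_gt0.
have /cvgrPdist_le/(_ _ e2)/nbhs_ballP[r1 /= r10 r1P] := continuous_ln cu.
have /cvgrPdist_le/(_ _ e2)/nbhs_ballP[r2 /= r20 r2P] :=
  @continuous_atan R (complex.Im u / complex.Re u).
set x0 := complex.Re u in u0 *; set y0 := complex.Im u.
(* [K] bounds the variation of [Im w / Re w] per unit of [|w - u|] as long as [Re w > x0 / 2]. *)
pose K := (x0 + `|y0|) / (x0 * x0 / 2).
have K0 : 0 <= K by rewrite divr_ge0 ?addr_ge0// ltW// ?divr_gt0 ?mulr_gt0.
exists (Num.min r1 (Num.min (x0 / 2) (r2 / (1 + K)))).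
  by rewrite !lt_min r10 !divr_gt0// ltr_pwDl.
move=> w; rewrite !lt_min => /and3P[w1 wx w2].
have H1 : `|ln (cabs u) - ln (cabs w)| <= e / 2.
  apply: r1P; apply: le_lt_trans w1.
  rewrite ler_norml; apply/andP; split.
    by rewrite lerNl opprB; exact: cabs_lerB.
  by rewrite cabsC; exact: cabs_lerB.
have xw : `|complex.Re w - x0| <= cabs (w - u).
  by rewrite /x0 -raddfB; exact: Re_cabs.
have yw : `|complex.Im w - y0| <= cabs (w - u).
  by rewrite /y0 -raddfB; exact: Im_cabs.
have x2 : x0 / 2 < complex.Re w.
  have := le_lt_trans xw wx; rewrite ltr_norml => /andP[+ _]; lra.
have xw0 : 0 < complex.Re w by apply: lt_trans x2; rewrite divr_gt0.
have H2 : `|atan (y0 / x0) - atan (complex.Im w / complex.Re w)| <= e / 2.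
  apply: r2P; rewrite /ball/=; move: w2; rewrite ltr_pdivlMr ?ltr_pwDl//.
  apply: le_lt_trans; apply: (@le_trans _ _ (cabs (w - u) * K)); last first.
    by rewrite ler_wpM2l ?cabs_ge0// lerDr.
  rewrite (_ : _ - _ = (y0 * (complex.Re w - x0) - x0 * (complex.Im w - y0))
                        / (x0 * complex.Re w)); last first.
    by field; rewrite !gt_eqF.
  rewrite normrM normfV (gtr0_norm (mulr_gt0 u0 xw0)) /K mulrA.
  apply: ler_pM; rewrite ?invr_ge0 ?mulr_ge0 ?(ltW u0) ?(ltW xw0)//.
    apply: le_trans (ler_normB _ _) _; rewrite !normrM (gtr0_norm u0).
    rewrite mulrDr addrC; apply: lerD; first by rewrite mulrC ler_wpM2r// ltW.
    by rewrite mulrC ler_wpM2r.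
  by rewrite lef_pV2 ?posrE ?divr_gt0 ?mulr_gt0// -mulrA ler_pM2l// ltW.
rewrite cabsC; apply: le_trans (cabs_ReIm _) _ => /=.
by rewrite (splitr e) lerD.
Qed.

(** Differentiation of an inverse. With [h = clog w - clog u], the derivative of [cexp] gives
    [|w - u - u h| <= d |h|]. The bound [d <= |u| / 2] then yields [|u| |h| <= 2 |w - u|], and
    [d <= e |u|^2 / 2] makes the final error [e |w - u|]. Continuity of [clog] is what makes [h]
    small. *)
Lemma cderiv_clog u : 0 < complex.Re u -> cderiv clog u u^-1.
Proof.
move=> u0 e e0; have cu := cabs_gt0_Re u0.
have un : u != 0 by rewrite -cabs_gt0.
have d0 : 0 < Num.min (cabs u / 2) (e * cabs u ^+ 2 / 2).
  by rewrite lt_min !divr_gt0 ?mulr_gt0 ?exprn_gt0.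
have d1 : Num.min (cabs u / 2) (e * cabs u ^+ 2 / 2) <= cabs u / 2.
  by rewrite ge_min lexx.
have d2 : Num.min (cabs u / 2) (e * cabs u ^+ 2 / 2) <= e * cabs u ^+ 2 / 2.
  by rewrite ge_min lexx orbT.
move: (Num.min _ _) d0 d1 d2 => d d0 d1 d2.
have [r r0 rP] := cderiv_cexp (clog u) d0.
have [s s0 sP] := clog_cont u0 (divr_gt0 r0 (ltr0Sn _ 1)).
exists (Num.min s (complex.Re u)) => [|w]; first by rewrite lt_min s0.
rewrite lt_min => /andP[ws wu].
have w0 : 0 < complex.Re w.
  have := le_lt_trans (Re_cabs _) wu; rewrite raddfB/= ltr_norml => /andP[+ _].
  by rewrite ltrBrDl subrr.
have := rP (clog w); rewrite !cexp_clog//.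
set h := clog w - clog u => /(_ _)/wrap[].
  by apply: le_lt_trans (sP _ ws) _; rewrite ltr_pdivrMr// ltr_pMr// ltr1n.
move=> H.
have h0 := cabs_ge0 h.
have uh : cabs u * cabs h <= 2 * cabs (w - u).
  have : cabs (u * h) - cabs (w - u) <= d * cabs h.
    by apply: le_trans (cabs_lerB _ _) _; rewrite cabsC.
  have : d * cabs h <= cabs u / 2 * cabs h by rewrite ler_wpM2r.
  rewrite cabsM; lra.
rewrite (_ : h - _ = - (u^-1 * (w - u - u * h))); last by field.
rewrite cabsN cabsM cabsV ler_pdivrMl//; apply: le_trans H _.
rewrite -(ler_pM2l cu).
apply: (@le_trans _ _ (d * (2 * cabs (w - u)))).
  by rewrite mulrCA ler_wpM2l// ltW.
apply: (@le_trans _ _ (e * cabs u ^+ 2 / 2 * (2 * cabs (w - u)))).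
  by rewrite ler_wpM2r// mulr_ge0 ?cabs_ge0.
by rewrite le_eqVlt; apply/orP; left; apply/eqP; field.
Qed.

(** The factor [(1 - w)^(-a)], written as an exponential so that the chain rule differentiates
    it. *)
Definition cesaro_weight (a : R) (w : R[i]) : R[i] := cexp ((- a)%:C%C * clog (1 - w)).

Lemma Re_1B (w : R[i]) : cabs w < 1 -> 0 < complex.Re (1 - w).
Proof.
move=> w1; rewrite raddfB/= subr_gt0.
exact: le_lt_trans (le_trans (ler_norm _) (Re_cabs w)) w1.
Qed.

Lemma cpow_weight (a : R) (w : R[i]) : cabs w < 1 ->
  cesaro_weight a w = (cpow (1 - w) a)^-1.
Proof.
move=> w1; have u0 := Re_1B w1; rewrite /cesaro_weight; move: (1 - w) u0 => u u0.
have cu := cabs_gt0_Re u0.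
have E : cpow u a = cexp (a%:C%C * clog u).
  rewrite /cpow; case: eqP => [u00|_]; first by move: cu; rewrite u00 cabs0 ltxx.
  have cl : complex.Re (a%:C%C * clog u) = a * ln (cabs u).
    by rewrite cReM/= mul0r subr0.
  have ci : complex.Im (a%:C%C * clog u) = a * atan (complex.Im u / complex.Re u).
    by rewrite cImM/= mul0r addr0.
  by rewrite /cexp cl ci /carg u0 /powR gt_eqF.
have H : cexp ((- a)%:C%C * clog u) * cexp (a%:C%C * clog u) = 1.
  by rewrite -cexpD -mulrDl -rmorphD addNr rmorph0 mul0r cexp0.
have n0 : cexp (a%:C%C * clog u) != 0 by rewrite -cabs_gt0 cabs_cexp expR_gt0.
by rewrite E; apply: (mulIf n0); rewrite H mulVf.
Qed.

Lemma cabs_weight (a : R) (w : R[i]) : cabs w < 1 ->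
  cabs (cesaro_weight a w) = cabs (1 - w) `^ (- a).
Proof.
move=> w1; have cu := cabs_gt0_Re (Re_1B w1).
rewrite /cesaro_weight cabs_cexp cReM/= mul0r subr0 /powR gt_eqF//.
Qed.

Lemma weight0 (a : R) : cesaro_weight a 0 = 1.
Proof.
rewrite cpow_weight ?cabs0// subr0.
rewrite /cpow oner_eq0 cabs1 powR1 /carg/= ltr01 mul0r atan0 mulr0 cos0 sin0.
by rewrite mulr1 mulr0 -[RHS]invr1.
Qed.

Lemma cderiv_weight (a : R) (w : R[i]) : cabs w < 1 ->
  cderiv (cesaro_weight a) w (cesaro_weight a w * (a%:C%C / (1 - w))).
Proof.
move=> w1; have H1 := cderivB (cderiv_cst 1 w) (cderiv_id w).
have H2 := @cderiv_comp R clog (fun w => 1 - w) w _ _ H1 (cderiv_clog (Re_1B w1)).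
have H3 := cderivZ (- a)%:C%C H2.
have := @cderiv_comp R cexp _ w _ _ H3 (cderiv_cexp _).
rewrite (_ : _ * (_ * _) = cesaro_weight a w * (a%:C%C / (1 - w)))//.
rewrite /cesaro_weight/=; congr (_ * _).
by rewrite raddfN/= sub0r; ring.
Qed.

Lemma cabs_weight_le (a rho : R) (w : R[i]) : 0 <= a -> rho < 1 -> cabs w <= rho ->
  cabs (cesaro_weight a w) <= (1 - rho) `^ (- a).
Proof.
move=> a0 r1 wr; have w1 := le_lt_trans wr r1.
have rw : 1 - rho <= cabs (1 - w).
  by apply: le_trans (cabs_lerB _ _); rewrite cabs1 lerD2l lerN2.
rewrite cabs_weight// !powRN lef_pV2 ?posrE ?powR_gt0 ?subr_gt0//.
  by apply: ge0_ler_powR => //; rewrite nnegrE ?cabs_ge0// subr_ge0 ltW.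
by apply: lt_le_trans rw; rewrite subr_gt0.
Qed.

Lemma cabs_dweight_le (a rho : R) (w : R[i]) : 0 <= a -> rho < 1 -> cabs w <= rho ->
  cabs (cesaro_weight a w * (a%:C%C / (1 - w))) <=
  (1 - rho) `^ (- a) * (a / (1 - rho)).
Proof.
move=> a0 r1 wr.
have rw : 1 - rho <= cabs (1 - w).
  by apply: le_trans (cabs_lerB _ _); rewrite cabs1 lerD2l lerN2.
have r1' : 0 < 1 - rho by rewrite subr_gt0.
rewrite !cabsM cabsV cabs_real ger0_norm//; apply: ler_pM.
- exact: cabs_ge0.
- by rewrite divr_ge0 ?cabs_ge0.
- exact: cabs_weight_le.
- by rewrite ler_wpM2l// lef_pV2 ?posrE// (lt_le_trans r1').
Qed.

End ExpLog.

(** * Bloch functions *)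

Section BlochFunctions.
Variable R : realType.
Implicit Types (f df : R[i] -> R[i]) (z w : R[i]) (a M rho : R).

(** This takes the place of continuity of the derivative in the integral arguments; for Bloch
    functions it is immediate from the norm. *)
Definition locally_bounded df := forall rho : R, rho < 1 ->
  exists2 L : R, 0 <= L & forall z, cabs z <= rho -> cabs (df z) <= L.

Lemma segment_cabs_le (rho : R) z w (t : R) : 0 <= t <= 1 ->
  cabs z <= rho -> cabs w <= rho -> cabs (z + t%:C%C * (w - z)) <= rho.
Proof.
move=> /andP[t0 t1] zr wr.
have -> : z + t%:C%C * (w - z) = (1 - t)%:C%C * z + t%:C%C * w.
  by rewrite raddfB/= rmorph1; ring.
apply: le_trans (cabsD _ _) _; rewrite !cabsM !cabs_real !ger0_norm ?subr_ge0//.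
have : (1 - t) * cabs z <= (1 - t) * rho by rewrite ler_wpM2l ?subr_ge0.
have : t * cabs w <= t * rho by rewrite ler_wpM2l.
lra.
Qed.

Lemma cderiv_disc_lip f df (rho L : R) : rho < 1 ->
  (forall z, cabs z < 1 -> cderiv f z (df z)) ->
  (forall z, cabs z <= rho -> cabs (df z) <= L) ->
  forall z w, cabs z <= rho -> cabs w <= rho -> cabs (f w - f z) <= L * cabs (w - z).
Proof.
move=> r1 fd dL z w zr wr; apply: (@cmean_value_lip R f df) => t t01.
  by apply/fd/(le_lt_trans _ r1); exact: segment_cabs_le.
by apply: dL; exact: segment_cabs_le.
Qed.

(** The derivative is an argument, so that a candidate such as an integral or a pointwise limit is
    certified together with the norm bound. *)
Definition bloch_bound a f df M := forall z, cabs z < 1 ->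
  cderiv f z (df z) /\ (1 - cabs z ^+ 2) `^ a * cabs (df z) <= M.

Lemma disc_sqr z : cabs z < 1 -> 0 < 1 - cabs z ^+ 2.
Proof. by move=> z1; rewrite subr_gt0 expr_lt1// cabs_ge0. Qed.

Lemma bloch_bound_le a f df M rho : 0 <= a -> bloch_bound a f df M -> 0 <= rho -> rho < 1 ->
  forall z, cabs z <= rho -> cabs (df z) <= M / (1 - rho ^+ 2) `^ a.
Proof.
move=> a0 fM r0 r1 z zr; have z1 := le_lt_trans zr r1.
have [_ H] := fM _ z1.
have r2 : 0 < 1 - rho ^+ 2 by rewrite subr_gt0 expr_lt1.
rewrite ler_pdivlMr ?powR_gt0// mulrC; apply: le_trans H.
rewrite ler_wpM2r ?cabs_ge0//; apply: ge0_ler_powR => //.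
- by rewrite nnegrE ltW.
- by rewrite nnegrE ltW// disc_sqr.
- by rewrite lerD2l lerN2 lerXn2r// nnegrE ?cabs_ge0.
Qed.

Lemma bloch_bound_ge0 a f df M : bloch_bound a f df M -> 0 <= M.
Proof.
move=> /(_ 0)[]; first by rewrite cabs0.
by move=> _; apply: le_trans; rewrite mulr_ge0 ?powR_ge0 ?cabs_ge0.
Qed.

Lemma bloch_bound_locally_bounded a f df M : 0 <= a -> bloch_bound a f df M ->
  locally_bounded df.
Proof.
move=> a0 fM rho r1; have [r0|r0] := leP 0 rho.
  exists (M / (1 - rho ^+ 2) `^ a); last exact: (bloch_bound_le a0 fM).
  by rewrite divr_ge0 ?powR_ge0// (bloch_bound_ge0 fM).
by exists 0 => // z zr; have := le_lt_trans zr r0; rewrite ltNge cabs_ge0.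
Qed.

(** At the point [tau z] of the ray, [|f'| <= M (1 - tau |z|)^(-a)], and [B] is the antiderivative
    of this majorant times [|z|]. The hypothesis [a < 1] makes the exponent [1 - a] positive, so the
    bound is small when [s z] is near the circle. *)
Lemma bloch_bound_radial a f df M (s : R) z : 0 < a < 1 -> bloch_bound a f df M ->
  0 <= s <= 1 -> cabs z < 1 ->
  cabs (f z - f (s%:C%C * z)) <= M / (1 - a) * (1 - s * cabs z) `^ (1 - a).
Proof.
move=> /andP[a0 a1] fM /andP[s0 s1] z1.
have M0 := bloch_bound_ge0 fM; have z0 := cabs_ge0 z.
have a1' : 0 < 1 - a by rewrite subr_gt0.
pose tau (t : R) := s + t * (1 - s).
have tau01 (t : R) : 0 <= t <= 1 -> 0 <= tau t <= 1.
  by move=> /andP[t0 t1]; rewrite /tau; apply/andP; split; nra.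
have tz (t : R) : 0 <= t <= 1 -> tau t * cabs z < 1.
  by move=> /tau01/andP[t0 t1]; apply: le_lt_trans z1; rewrite ler_piMl.
have ptE (t : R) : s%:C%C * z + t%:C%C * (z - s%:C%C * z) = (tau t)%:C%C * z.
  by rewrite /tau raddfD/= rmorphM/= raddfB/= rmorph1; ring.
have cpt (t : R) : 0 <= t <= 1 -> cabs ((tau t)%:C%C * z) = tau t * cabs z.
  by move=> /tau01/andP[t0 t1]; rewrite cabsM cabs_real ger0_norm.
pose B (t : R) := - (M / (1 - a)) * (1 - tau t * cabs z) `^ (1 - a).
pose dB (t : R) := M * ((1 - tau t * cabs z) `^ (- a) * ((1 - s) * cabs z)).
have H : cabs (f z - f (s%:C%C * z)) <= B 1 - B 0.
  apply: (@cmean_value R f df _ _ B dB) => t t01.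
  - by rewrite ptE; apply: (fM _ _).1; rewrite cpt// tz.
  - have gd : is_derive t 1 (fun t : R => 1 - tau t * cabs z) (- ((1 - s) * cabs z)).
      apply/is_derive_realP => e e0; exists 1 => // y _.
      rewrite /tau (_ : _ - _ - _ = 0) ?normr0 ?mulr_ge0// ?ltW//.
      by ring.
    have pd := @is_derive1_powR R (1 - a) (1 - tau t * cabs z) _.
    have u0 : 0 < 1 - tau t * cabs z by rewrite subr_gt0 tz.
    have K := @is_derive1_comp R _ _ t _ _ (pd u0) gd.
    have {}K : is_derive t 1 B (- (M / (1 - a)) * ((1 - a) *
        (1 - tau t * cabs z) `^ (1 - a - 1) * (- ((1 - s) * cabs z)))).
      exact: (@is_deriveZ R R R _ (- (M / (1 - a))) t 1 _ K).
    apply: is_derive_eq; rewrite /dB (_ : 1 - a - 1 = - a); last by ring.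
    by field; rewrite gt_eqF.
  - rewrite ptE /dB.
    have zt : cabs ((tau t)%:C%C * z) < 1 by rewrite cpt// tz.
    have [_] := fM _ zt; rewrite cpt// mulrC -ler_pdivlMr; last first.
      by rewrite powR_gt0// -(cpt _ t01) disc_sqr.
    move=> H.
    have -> : z - s%:C%C * z = (1 - s)%:C%C * z by rewrite raddfB/= rmorph1; ring.
    rewrite !cabsM cabs_real ger0_norm ?subr_ge0// [leRHS]mulrA.
    rewrite ler_wpM2r ?mulr_ge0 ?subr_ge0//; apply: le_trans H _.
    (* What remains is [1 - tau |z| <= 1 - (tau |z|)^2], true since [tau |z| < 1]. *)
    rewrite ler_wpM2l// powRN lef_pV2 ?posrE ?powR_gt0 ?subr_gt0 ?tz//; last first.
      by rewrite -(cpt _ t01) -subr_gt0 disc_sqr.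
    have /andP[tt0 tt1] := tau01 _ t01.
    apply: ge0_ler_powR; rewrite ?nnegrE ?subr_ge0 ?(ltW a0)//.
    + by rewrite ltW// tz.
    + by rewrite ltW// -(cpt _ t01) -subr_gt0 disc_sqr.
    + by rewrite lerD2l lerN2 expr2 ler_piMl ?mulr_ge0// ltW// tz.
(* The contribution of [tau = 1] is nonpositive and is dropped. *)
apply: le_trans H _; rewrite /B.
rewrite (_ : tau 0 = s); last by rewrite /tau mul0r addr0.
rewrite (_ : _ - _ = M / (1 - a) * (1 - s * cabs z) `^ (1 - a) -
   M / (1 - a) * (1 - tau 1 * cabs z) `^ (1 - a)); last by ring.
by rewrite lerBlDr lerDl mulr_ge0 ?powR_ge0// divr_ge0// ltW.
Qed.

Lemma bloch_bound_sup a f df M z : 0 < a < 1 -> bloch_bound a f df M ->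
  f 0 = 0 -> cabs z < 1 -> cabs (f z) <= M / (1 - a).
Proof.
move=> a01 fM f0 z1; have := @bloch_bound_radial a f df M 0 z a01 fM.
by rewrite lexx ler01 mul0r f0 !subr0 mul0r subr0 powR1 mulr1; apply.
Qed.

(** Inside [|z| <= rho] the functions share a Lipschitz constant. Near the circle both points are
    first pulled inward by the factor [rho], which the radial estimate allows at a cost of [e / 3]
    each. *)
Lemma bloch_equicontinuous a : 0 < a < 1 -> forall e : R, 0 < e ->
  exists2 d : R, 0 < d & forall f df, bloch_bound a f df 1 ->
    forall z w, cabs z < 1 -> cabs w < 1 -> cabs (z - w) < d -> cabs (f z - f w) <= e.
Proof.
move=> a01 e e0; have /andP[a0 a1] := a01.
have a1' : 0 < 1 - a by rewrite subr_gt0.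
have e3 : 0 < e / 3 * (1 - a) by rewrite mulr_gt0// divr_gt0.
have /cvgrPdist_le/(_ _ e3) := powR_cvg0 a1'.
move=> [r /= r0 rP].
(* With [rho = 1 - eta], a point with [|x| >= 1 - 2 eta] has [1 - rho |x| <= 3 eta], which is below
   the threshold [r]. *)
have [eta [eta0 eta2 etar]] : exists eta : R, [/\ 0 < eta, eta <= 2^-1 & 4 * eta < r].
  exists (Num.min 2^-1 (r / 8)); split.
  - by rewrite lt_min invr_gt0 ltr0Sn divr_gt0.
  - by rewrite ge_min lexx.
  - have : Num.min 2^-1 (r / 8) <= r / 8 by rewrite ge_min lexx orbT.
    lra.
have small (x : R) : 0 < x -> x <= 4 * eta -> 1 / (1 - a) * x `^ (1 - a) <= e / 3.
  move=> x0 xe; rewrite mul1r ler_pdivrMl// mulrC.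
  have := rP x; rewrite /= sub0r normrN gtr0_norm// => /(_ (le_lt_trans xe etar) x0).
  by rewrite sub0r normrN ger0_norm// powR_ge0.
pose rho := 1 - eta.
have rho0 : 0 <= rho by rewrite /rho; lra.
have rho1 : rho < 1 by rewrite /rho; lra.
have q0 : 0 < (1 - rho ^+ 2) `^ a by rewrite powR_gt0// subr_gt0 expr_lt1.
pose L := 1 / (1 - rho ^+ 2) `^ a.
have L0 : 0 < L by rewrite divr_gt0.
have m0 : 0 < Num.min eta (e / 3 / L) by rewrite lt_min eta0 !divr_gt0.
exists (Num.min eta (e / 3 / L)) => // f df fM z w z1 w1.
rewrite lt_min => /andP[zwe]; rewrite ltr_pdivlMr// => zwL.
have lip z' w' : cabs z' <= rho -> cabs w' <= rho -> cabs (z' - w') <= cabs (z - w) ->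
    cabs (f z' - f w') <= e / 3.
  move=> z'r w'r zw; apply: le_trans (@cderiv_disc_lip f df rho L rho1 _ _ w' z' w'r z'r) _.
  - by move=> x /fM[].
  - exact: (bloch_bound_le (ltW a0) fM).
  - by apply: le_trans (ltW zwL); rewrite mulrC ler_wpM2r// ltW.
have ze := cabs_ge0 z; have we := cabs_ge0 w.
have [zw|zw] := boolP ((cabs z <= rho) && (cabs w <= rho)).
  by case/andP: zw => zr wr; apply: le_trans (lip _ _ zr wr (lexx _)) _; lra.
have dzw : `|cabs z - cabs w| < eta.
  apply: le_lt_trans zwe; rewrite ler_norml; apply/andP; split.
    by rewrite lerNl opprB cabsC; exact: cabs_lerB.
  exact: cabs_lerB.
move: dzw; rewrite ltr_norml => /andP[d1 d2].
(* One of the points lies beyond [1 - eta], and the other is closer than [eta] to it. *)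
have zwl : 1 - 2 * eta <= cabs z /\ 1 - 2 * eta <= cabs w.
  by move: zw; rewrite negb_and -!ltNge /rho => /orP[]; lra.
case: zwl => zl wl.
have rad x : cabs x < 1 -> 1 - 2 * eta <= cabs x -> cabs (f x - f (rho%:C%C * x)) <= e / 3.
  move=> x1 xl; have x0 := cabs_ge0 x.
  have rx : rho * cabs x <= cabs x by rewrite ler_piMl// ltW.
  apply: le_trans (bloch_bound_radial a01 fM _ x1) _.
    by rewrite rho0 ltW.
  apply: small; first by lra.
  have : eta * cabs x <= eta by rewrite ler_piMr// ltW.
  rewrite /rho; lra.
have rhox x : cabs x < 1 -> cabs (rho%:C%C * x) <= rho.
  by move=> x1; rewrite cabsM cabs_real ger0_norm// ler_piMr// ltW.
have := rad z z1 zl; have := rad w w1 wl.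
have : cabs (f (rho%:C%C * z) - f (rho%:C%C * w)) <= e / 3.
  apply: lip; [exact: rhox|exact: rhox|].
  by rewrite -mulrBr cabsM cabs_real ger0_norm// ler_piMl ?cabs_ge0// ltW.
have := cabs_split (f (rho%:C%C * z)) (f z) (f w).
have := cabs_split (f (rho%:C%C * w)) (f (rho%:C%C * z)) (f w).
rewrite (cabsC (f (rho%:C%C * w)) (f w)); lra.
Qed.

Lemma bloch_norm_le a (f : Cplx R -> Cplx R) df M : bloch_bound a f df M ->
  (bloch_norm a f <= M%:E)%E.
Proof.
move=> fM; apply: ge_ereal_sup => _ [z z1 <-]; rewrite lee_fin.
by have [/cderiv_derive1[_ ->]] := fM z z1.
Qed.

Lemma bloch_norm_bound a (f : Cplx R -> Cplx R) M :
  holomorphic_on (@disc R) f -> (bloch_norm a f <= M%:E)%E ->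
  bloch_bound a f (derive1 f) M.
Proof.
move=> fh fM z z1; split; first by apply: derivable_cderiv; exact: fh.
rewrite -lee_fin; apply: le_trans fM; apply: ereal_sup_ubound.
by exists z.
Qed.

Lemma bloch_norm_ge0 a (f : Cplx R -> Cplx R) : (0 <= bloch_norm a f)%E.
Proof.
apply: le_trans (ereal_sup_ubound _); last first.
  by exists (0 : Cplx R) => //=; rewrite /disc/= cabs0.
by rewrite lee_fin mulr_ge0 ?powR_ge0 ?cabs_ge0.
Qed.

Lemma bloch0_bound a (f : Cplx R -> Cplx R) : bloch0 a f ->
  exists M, bloch_bound a f (derive1 f) M.
Proof.
move=> [fh [_ [_ foo]]].
exists (fine (bloch_norm a f)); apply: bloch_norm_bound => //.
by rewrite fineK// ge0_fin_numE// bloch_norm_ge0.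
Qed.

Lemma bloch_bound_bloch0 a (f : Cplx R -> Cplx R) df M : bloch_bound a f df M ->
  f 0 = 0 -> (forall z, ~ disc z -> f z = 0) -> bloch0 a f.
Proof.
move=> fM f0 foff; split; first by move=> z z1; have [/cderiv_derive1[]] := fM z z1.
split=> //; split=> //.
exact: le_lt_trans (bloch_norm_le fM) (ltry _).
Qed.

End BlochFunctions.

(** * Primitives along rays *)

Section RadialPrimitive.
Variable R : realType.
Variables (F dF : R[i] -> R[i]).
Hypothesis F_deriv : forall z, cabs z < 1 -> cderiv F z (dF z).
Hypothesis dF_bounded : locally_bounded dF.
Hypothesis F0 : F 0 = 0.

(* [F (t z) / t], extended by continuity at [t = 0]. *)
Definition radial_kernel (t : R) (z : R[i]) : R[i] :=
  if t == 0 then dF 0 * z else t%:C%C^-1 * F (t%:C%C * z).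

Let scale_lt1 (t : R) z : 0 <= t <= 1 -> cabs z < 1 -> cabs (t%:C%C * z) < 1.
Proof.
move=> /andP[t0 t1] z1; rewrite cabsM cabs_real ger0_norm//.
by apply: le_lt_trans z1; rewrite ler_piMl ?cabs_ge0.
Qed.

(** At [t = 0] this is differentiability of [F] at the origin, with [F 0 = 0]. *)
Lemma radial_kernel_cont z (t : R) : cabs z < 1 -> 0 <= t <= 1 ->
  ccont (fun s => radial_kernel s z) t.
Proof.
move=> z1 t01; have [t0|t0] := eqVneq t 0.
  have K0 : 0 < 1 + cabs z by rewrite ltr_pwDl ?cabs_ge0.
  move=> e e0; have [|r r0 rP] := @F_deriv 0 _ _ (divr_gt0 e0 K0).
    by rewrite cabs0.
  exists (r / (1 + cabs z)) => [|s]; first exact: divr_gt0.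
  rewrite t0 subr0 ltr_pdivlMr// => sr.
  rewrite /radial_kernel eqxx; case: eqVneq => [_|s0].
    by rewrite subrr cabs0 ltW.
  have sC : s%:C%C != 0 :> R[i] by rewrite -cabs_gt0 cabs_real normr_gt0.
  have ns : 0 < `|s| by rewrite normr_gt0.
  have := rP (s%:C%C * z); rewrite F0 !subr0 cabsM cabs_real => H.
  rewrite (_ : _ - _ = s%:C%C^-1 * (F (s%:C%C * z) - dF 0 * (s%:C%C * z))); last first.
    by field.
  rewrite cabsM cabsV cabs_real ler_pdivrMl//; apply: le_trans (H _) _.
    by apply: le_lt_trans sr; rewrite ler_wpM2l// lerDr.
  rewrite mulrCA ler_wpM2l// mulrAC ler_pdivrMr// ler_wpM2l ?(ltW e0)//.
  by rewrite lerDr.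
apply: (@ccont_eq R (fun s => s%:C%C^-1 * F (s%:C%C * z))).
  exists `|t| => [|s st]; first by rewrite normr_gt0.
  rewrite /radial_kernel; case: eqVneq => // s0.
  by move: st; rewrite s0 sub0r normrN ltxx.
apply: ccontM.
  apply: (@cderiv_ccont R (fun w => w^-1) (fun s => s%:C%C) t _ _ (@ccont_real R t)).
  apply: cderivV (cderiv_id _).
  by rewrite -cabs_gt0 cabs_real normr_gt0.
apply: (@cderiv_ccont R F (fun s => s%:C%C * z) t); first exact: F_deriv (scale_lt1 t01 z1).
by apply: ccontM; [exact: ccont_real|exact: ccont_cst].
Qed.

Lemma radial_kernel_integrable z : cabs z < 1 -> cintegrable (radial_kernel ^~ z).
Proof. by move=> z1; apply: ccont_integrable => t; exact: radial_kernel_cont. Qed.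

Let radial_kernel_deriv (t : R) z : 0 <= t <= 1 -> cabs z < 1 ->
  cderiv (radial_kernel t) z (dF (t%:C%C * z)).
Proof.
move=> t01 z1; rewrite /radial_kernel; case: eqVneq => [->|t0].
  rewrite mul0r -[X in cderiv _ _ X]mulr1.
  exact: cderivZ (cderiv_id _).
have tC : t%:C%C != 0 :> R[i] by rewrite -cabs_gt0 cabs_real normr_gt0.
have := cderivZ t%:C%C^-1 (cderiv_scale (F_deriv (scale_lt1 t01 z1))).
by rewrite mulrCA mulVf// mulr1.
Qed.

Definition radial_primitive z := cint01 (radial_kernel ^~ z).
Definition radial_derivative z := cint01 (fun t => dF (t%:C%C * z)).

Lemma cderiv_radial_primitive z : cabs z < 1 ->
  cderiv radial_primitive z (radial_derivative z).
Proof.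
move=> z1; pose rho := (1 + cabs z) / 2; have z0 := cabs_ge0 z.
have rho1 : rho < 1 by rewrite /rho; lra.
have [L L0 LP] := dF_bounded rho1.
have r0 : 0 < rho - cabs z by rewrite /rho; lra.
have near w : cabs (w - z) < rho - cabs z -> cabs w <= rho.
  by move=> wz; have := cabs_lerB w z; lra.
apply: (@cderiv_cint01 R radial_kernel _ z _ L r0).
- by move=> w /near wr; apply: radial_kernel_integrable; exact: le_lt_trans wr rho1.
- by move=> t t01; exact: radial_kernel_deriv.
- move=> t w t01 wz; rewrite cabsC [cabs (w - z)]cabsC.
  apply: (@cmean_value_lip R (radial_kernel t) (fun x => dF (t%:C%C * x))) => s s01.
    apply: radial_kernel_deriv => //; apply: le_lt_trans rho1.
    by apply: segment_cabs_le => //; [exact: near|rewrite /rho; lra].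
  apply: LP; have /andP[t0 t1] := t01.
  rewrite cabsM cabs_real ger0_norm//.
  have zr : cabs z <= rho by rewrite /rho; lra.
  by apply: le_trans (segment_cabs_le s01 (near _ wz) zr); rewrite ler_piMl ?cabs_ge0.
Qed.

Lemma radial_derivative0 : radial_derivative 0 = dF 0.
Proof.
rewrite /radial_derivative -[RHS](cint01_cst (dF 0)); congr cint01.
by apply/funext => t; rewrite mulr0.
Qed.

(* Both sides are the radial derivative of the primitive; the fundamental
   theorem of calculus cannot be applied to [t |-> F (t z)], whose derivative
   is bounded but not known to be continuous. *)
Lemma radial_derivativeE z : cabs z < 1 -> z * radial_derivative z = F z.
Proof.
move=> z1; apply/eqP; rewrite -subr_eq0 -cabs_eq0; apply/eqP.
apply/le_anti; rewrite cabs_ge0 andbT; apply/ler_addgt0Pr => e e0; rewrite add0r.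
have K0 : 0 < 1 + cabs z by rewrite ltr_pwDl ?cabs_ge0.
have e1 : 0 < e / (1 + cabs z) by rewrite divr_gt0.
have [r r0 rP] := cderiv_radial_primitive z1 e1.
have [|r' r'0 r'P] := @radial_kernel_cont z 1 z1 _ _ e1; first by rewrite ler01 lexx.
pose h := Num.min 2^-1 (Num.min (r / 2) (r' / 2)).
have h0 : 0 < h by rewrite !lt_min invr_gt0 ltr0Sn !divr_gt0.
have h2 : h <= 2^-1 by rewrite ge_min lexx.
have hr : h <= r / 2 by rewrite !ge_min lexx orbT.
have hr' : h <= r' / 2 by rewrite !ge_min lexx !orbT.
move: h h0 h2 hr hr' => h h0 h2 hr hr'.
pose s := 1 - h.
have s0 : 0 < s by rewrite /s; lra.
have s1 : s < 1 by rewrite /s; lra.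
have sh : 1 - s = h by rewrite /s; ring.
have sC : s%:C%C != 0 :> R[i] by rewrite -cabs_gt0 cabs_real normr_gt0 gt_eqF.
have hC : h%:C%C != 0 :> R[i] by rewrite -cabs_gt0 cabs_real normr_gt0 gt_eqF.
pose X := cint01 (fun t => radial_kernel (s + (1 - s) * t) z).
have Xi : cintegrable (fun t => radial_kernel (s + (1 - s) * t) z).
  apply: ccont_integrable => t /andP[t0 t1].
  apply: (@ccont_affine R (fun t => radial_kernel t z)).
  by apply: radial_kernel_cont => //; rewrite sh; apply/andP; split; nra.
(* Since [s * radial_kernel (s * t) z = radial_kernel t (s z)], the part of the integral before
   [s = 1 - h] is the primitive at [s z]. The mean [X] over the rest is close to
   [radial_kernel 1 z = F z], so the increment of the primitive divided by [h] approximates both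
   sides of the claim. *)
have GE : radial_primitive z = radial_primitive (s%:C%C * z) + h%:C%C * X.
  rewrite {1}/radial_primitive (@cint01_split R _ s) ?s0//; last first.
    by move=> t; exact: radial_kernel_cont.
  rewrite -sh; congr (_ + _).
  rewrite -cint01Z; last first.
    apply: ccont_integrable => t /andP[t0 t1].
    rewrite (_ : (fun _ => _) = (fun t => radial_kernel (0 + s * t) z)); last first.
      by apply/funext => x; rewrite add0r.
    apply: (@ccont_affine R (fun t => radial_kernel t z)).
    by apply: radial_kernel_cont => //; rewrite add0r; apply/andP; split; nra.
  congr cint01; apply/funext => t; rewrite /radial_kernel mulf_eq0 (gt_eqF s0)/=.
  case: eqVneq => [_|t0]; first by rewrite mulrCA.
  have tC : t%:C%C != 0 :> R[i] by rewrite -cabs_gt0 cabs_real normr_gt0.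
  rewrite rmorphM/= invfM !mulrA mulfV// mul1r; congr (_ * F _).
  by rewrite [in RHS]mulrC mulrA; ring.
have X1 : cabs (X - F z) <= e / (1 + cabs z).
  have -> : X - F z = cint01 (fun t => radial_kernel (s + (1 - s) * t) z + (-1) * F z).
    rewrite cint01D; last 2 first.
    - exact: Xi.
    - by apply: ccont_integrable => t _; exact: ccont_cst.
    by rewrite cint01_cst mulN1r.
  apply: cint01_le.
    apply: cintegrableD => //.
    by apply: ccont_integrable => t _; exact: ccont_cst.
  move=> t /andP[t0 t1]; have := r'P (s + (1 - s) * t).
  rewrite {2}/radial_kernel oner_eq0 rmorph1 invr1 !mul1r mulN1r; apply.
  rewrite sh /s ler0_norm; nra.
have sz : s%:C%C * z - z = - (h%:C%C * z).
  by rewrite /s raddfB/= rmorph1; ring.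
have := rP (s%:C%C * z); rewrite sz cabsN cabsM cabs_real gtr0_norm// => H.
have {}H : cabs (radial_primitive (s%:C%C * z) - radial_primitive z -
    radial_derivative z * - (h%:C%C * z)) <= e / (1 + cabs z) * (h * cabs z).
  apply: H; apply: (@le_lt_trans _ _ h); first by rewrite ler_piMr// ltW.
  by apply: le_lt_trans hr _; rewrite ltr_pdivrMr// ltr_pMr// ltr1n.
move: H; rewrite GE.
rewrite (_ : _ - _ - _ = h%:C%C * (z * radial_derivative z - X)); last by ring.
rewrite cabsM cabs_real gtr0_norm// mulrCA ler_pM2l// => H.
apply: le_trans (cabs_split X _ _) _.
rewrite [leRHS](_ : e = e / (1 + cabs z) * cabs z + e / (1 + cabs z)); last first.
  by field; rewrite gt_eqF.
exact: lerD.
Qed.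

End RadialPrimitive.

(** * Cauchy's estimate *)

Section CauchyEstimate.
Variable R : realType.
Variables (v dv : R[i] -> R[i]).
Hypothesis v_deriv : forall z, cabs z < 1 -> cderiv v z (dv z).
Hypothesis dv_bounded : locally_bounded dv.

Let e (t : R) : R[i] := cexp (Complex 0 (pi *+ 2 * t)).

Let cabs_e t : cabs (e t) = 1.
Proof. by rewrite cabs_cexp/= expR0. Qed.

Let eD s t : e (s + t) = e s * e t.
Proof.
by rewrite -cexpD; congr cexp; apply: eq_ReIm => /=; rewrite ?addr0// mulrDr.
Qed.

Let eS t : e (1 + t) = e t.
Proof.
by rewrite /e /cexp/= mulrDr mulr1 addrC cosD2pi sinD2pi.
Qed.

Let e0 : e 0 = 1.
Proof. by rewrite /e mulr0 -[RHS](cexp0 R). Qed.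

Let eN0 t : e t != 0.
Proof. by rewrite -cabs_gt0 cabs_e. Qed.

Let eV t : e (- t) = (e t)^-1.
Proof. by apply: (mulIf (eN0 t)); rewrite -eD addNr e0 mulVf. Qed.

Let e_cont t : ccont e t.
Proof.
have -> : e = @cexp R \o (fun t : R => Complex 0 (pi *+ 2) * t%:C%C).
  apply/funext => x; rewrite /e/=; congr cexp.
  by apply: eq_ReIm; rewrite ?cReM ?cImM/= ?mulr0 ?mul0r ?subr0 ?add0r.
apply: cderiv_ccont; first exact: cderiv_cexp.
by apply: ccontM; [exact: ccont_cst|exact: ccont_real].
Qed.

(** Cutting the left side at [1 - c] and the right side at [c] produces the same two pieces in
    opposite order. *)
Let cint01_periodic (q : R -> R[i]) (c : R) : 0 < c < 1 ->
  (forall t, ccont q t) -> (forall t, q (1 + t) = q t) ->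
  cint01 (fun t => q (c + t)) = cint01 q.
Proof.
move=> /andP[c0 c1] qc qp.
have c1' : 0 < 1 - c < 1 by apply/andP; split; lra.
have shift t : ccont (fun t => q (c + t)) t.
  have := @ccont_affine R q c 1 t (qc _).
  rewrite (_ : (fun s => q (c + 1 * s)) = (fun t => q (c + t)))//.
  by apply/funext => x; rewrite mul1r.
rewrite (cint01_split c1') => [|t _]; last exact: shift.
rewrite [RHS](@cint01_split _ _ c) ?c0//.
rewrite addrC subKr; congr (_ * _ + _ * _).
congr cint01; apply/funext => t.
by rewrite addrA subrKC qp.
Qed.

Section Circle.
Variables (a : R[i]) (r : R).
Hypothesis ar : cabs a + r <= 1.

Let k (t : R) (z : R[i]) : R[i] := v (a + z * e t) * e (- t).

Let in_disc z t : cabs z < r -> cabs (a + z * e t) < 1.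
Proof.
move=> zr; apply: lt_le_trans ar; apply: le_lt_trans (cabsD _ _) _.
by rewrite cabsM cabs_e mulr1 ltrD2l.
Qed.

Let k_cont z t : cabs z < r -> ccont (fun t => k t z) t.
Proof.
move=> zr; apply: ccontM.
  apply: (@cderiv_ccont R v (fun t => a + z * e t)); first exact: v_deriv (in_disc _ zr).
  apply: ccontD; first exact: ccont_cst.
  by apply: ccontM; [exact: ccont_cst|exact: e_cont].
have := @ccont_affine R e 0 (-1) t (e_cont _).
rewrite (_ : (fun s => e (0 + -1 * s)) = (fun t => e (- t)))//.
by apply/funext => x; rewrite add0r mulN1r.
Qed.

Let Psi z := cint01 (fun t => k t z).
Let dPsi z := cint01 (fun t => dv (a + z * e t)).

Let k_deriv t z : cabs z < r -> cderiv (k t) z (dv (a + z * e t)).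
Proof.
move=> zr.
have H1 := cderivD (cderiv_cst a z) (cderivM (cderiv_id z) (cderiv_cst (e t) z)).
have H2 := @cderiv_comp R v (fun z => a + z * e t) z _ _ H1 (v_deriv (in_disc t zr)).
have := cderivM H2 (cderiv_cst (e (- t)) z).
set D := (X in cderiv _ _ X -> _).
rewrite (_ : D = dv (a + z * e t))// /D eV.
by field; rewrite eN0.
Qed.

Let Psi_deriv z : cabs z < r -> cderiv Psi z (dPsi z).
Proof.
move=> zr; pose rho := cabs a + (r + cabs z) / 2; have z0 := cabs_ge0 z.
have rho1 : rho < 1 by have := ar; rewrite /rho; lra.
have [L L0 LP] := dv_bounded rho1.
have r0 : 0 < (r - cabs z) / 2 by lra.
have near w : cabs (w - z) < (r - cabs z) / 2 -> cabs w <= (r + cabs z) / 2.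
  by move=> wz; have := cabs_lerB w z; lra.
have nearr w : cabs w <= (r + cabs z) / 2 -> cabs w < r by lra.
apply: (@cderiv_cint01 R k _ z _ L r0).
- by move=> w /near/nearr wr; apply: ccont_integrable => t _; exact: k_cont.
- by move=> t _; exact: k_deriv.
- move=> t w _ /near wz.
  apply: (@cmean_value_lip R (k t) (fun z => dv (a + z * e t))) => s s01.
    apply/k_deriv/nearr/segment_cabs_le => //; lra.
  apply: LP; apply: le_trans (cabsD _ _) _.
  rewrite cabsM cabs_e mulr1 lerD2l; apply: segment_cabs_le => //; lra.
Qed.

Let Psi_rot z (c : R) : 0 < c < 1 -> cabs z < r -> Psi (z * e c) = e c * Psi z.
Proof.
move=> c01 zr; rewrite /Psi -(@cint01_periodic (fun t => k t z) c c01).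
- rewrite -cint01Z.
    congr cint01; apply/funext => t; rewrite /k eD opprD eD !eV (mulrA z).
    by move: (v _) => V; field; rewrite !eN0.
  apply: ccont_integrable => t _.
  have := @ccont_affine R (fun t => k t z) c 1 t (k_cont _ zr).
  rewrite (_ : (fun s => k (c + 1 * s) z) = (fun t => k (c + t) z))//.
  by apply/funext => x; rewrite mul1r.
- by move=> t; exact: k_cont.
- by move=> t; rewrite /k eS eV eS -eV.
Qed.

(** Differentiation along the circle through [z]: from [z] to [z * e c] the increment of [Psi] is
    exactly [(e c - 1) * Psi z], while the derivative predicts [(e c - 1) * z * dPsi z]. Dividing by
    [e c - 1] with [c] small compares the two. *)
Let Psi_euler z : cabs z < r -> z * dPsi z = Psi z.
Proof.
move=> zr; apply/eqP; rewrite -subr_eq0 -cabs_eq0; apply/eqP.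
apply/le_anti; rewrite cabs_ge0 andbT; apply/ler_addgt0Pr => eps eps0; rewrite add0r.
have K0 : 0 < 1 + cabs z by rewrite ltr_pwDl ?cabs_ge0.
have [d d0 dP] := Psi_deriv zr (divr_gt0 eps0 K0).
have d1 : 0 < d / (1 + cabs z) by rewrite divr_gt0.
have [s s0 sP] := @e_cont 0 _ (divr_gt0 d1 (ltr0Sn _ 1)).
pose c := Num.min 2^-1 (s / 2).
have c0 : 0 < c by rewrite lt_min invr_gt0 ltr0Sn divr_gt0.
have c2 : c <= 2^-1 by rewrite ge_min lexx.
have cs : c <= s / 2 by rewrite ge_min lexx orbT.
move: c c0 c2 cs => c c0 c2 cs.
have c01 : 0 < c < 1 by rewrite c0; lra.
have ecd : cabs (e c - 1) < d / (1 + cabs z).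
  rewrite -e0; apply: le_lt_trans (sP _ _) _.
    by rewrite subr0 gtr0_norm//; lra.
  by rewrite ltr_pdivrMr// ltr_pMr// ltr1n.
(* As [0 < c <= 1/2], the angle [2 pi c] lies in []0, pi]], where the cosine is injective. *)
have ec1 : e c - 1 != 0.
  rewrite subr_eq0; apply/eqP => /(congr1 (@complex.Re R))/=.
  rewrite expR0 mul1r -[in RHS](@cos0 R) => /cos_inj.
  have pc : 0 < pi *+ 2 * c by rewrite mulr_gt0// mulrn_wgt0// pi_gt0.
  rewrite !in_itv/= lexx pi_ge0 ltW// => /(_ _ isT)/wrap[].
    by rewrite mulrnAl -mulrnAr ler_piMr ?pi_ge0//; lra.
  by move=> pc0; move: pc; rewrite pc0 ltxx.
have := dP (z * e c); rewrite Psi_rot// => H.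
have {}H : cabs (e c * Psi z - Psi z - dPsi z * (z * e c - z)) <=
    eps / (1 + cabs z) * (cabs z * cabs (e c - 1)).
  have zE : z * e c - z = z * (e c - 1) by ring.
  rewrite zE cabsM in H *; apply: H.
  move: ecd; rewrite ltr_pdivlMr// => ecd; apply: le_lt_trans ecd.
  by rewrite mulrC ler_wpM2l ?cabs_ge0// lerDr.
move: H; rewrite (_ : _ - _ - _ = - (z * dPsi z - Psi z) * (e c - 1)); last by ring.
rewrite cabsM cabsN mulrA ler_pM2r ?cabs_gt0// => /le_trans; apply.
by rewrite mulrAC ler_pdivrMr// ler_wpM2l ?(ltW eps0)// lerDr.
Qed.

(** The estimate is read off at the radius [x], strictly below [r], because [Psi] is differentiated
    only on the open disc of radius [r]. *)
Lemma cauchy_estimate (x eps : R) : 0 < x -> x < r ->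
  (forall z, cabs z < 1 -> cabs (v z) <= eps) -> cabs (dv a) <= eps / x.
Proof.
move=> x0 xr veps.
have r0 : 0 < r by exact: lt_trans xr.
have Psi_le z : cabs z < r -> cabs (Psi z) <= eps.
  move=> zr; apply: cint01_le.
    by apply: ccont_integrable => t _; exact: k_cont.
  by move=> t _; rewrite cabsM cabs_e mulr1; apply/veps/in_disc.
have Psi0 : Psi 0 = 0.
  by rewrite -Psi_euler ?cabs0// mul0r.
have dPsi0 : dPsi 0 = dv a.
  rewrite /dPsi -[RHS](cint01_cst (dv a)); congr cint01.
  by apply/funext => t; rewrite mul0r addr0.
(* Euler's relation makes [Psi z / z] constant along a ray. *)
have const (y : R) : 0 < y -> y <= x -> Psi y%:C%C / y%:C%C = Psi x%:C%C / x%:C%C.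
  move=> y0 yx; apply/eqP; rewrite eq_sym -subr_eq0 -cabs_eq0; apply/eqP/le_anti.
  rewrite cabs_ge0 andbT.
  pose f z := Psi z * z^-1.
  have := @cmean_value_lip R f (fun=> 0) y%:C%C x%:C%C 0.
  rewrite mul0r /f; apply => [t /andP[t0 t1]|t _]; last by rewrite cabs0.
  have -> : y%:C%C + t%:C%C * (x%:C%C - y%:C%C) = (y + t * (x - y))%:C%C.
    by rewrite raddfD/= rmorphM/= raddfB.
  set w := y + t * (x - y).
  have w0 : 0 < w by rewrite /w ltr_pwDl// mulr_ge0// subr_ge0.
  have wx : w <= x by have : t * (x - y) <= x - y by [rewrite ler_piMl// subr_ge0]; rewrite /w; lra.
  have wr : cabs w%:C%C < r by rewrite cabs_real gtr0_norm// (le_lt_trans wx).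
  have wC : w%:C%C != 0 :> R[i] by rewrite -cabs_gt0 cabs_real normr_gt0 gt_eqF.
  have DE : dPsi w%:C%C * (w%:C%C)^-1 + Psi w%:C%C * (- 1 / w%:C%C ^+ 2) = 0.
    have G (A B c : R[i]) : c != 0 -> c * A = B -> A * c^-1 + B * (- 1 / c ^+ 2) = 0.
      by move=> c0 <-; field.
    exact: G wC (Psi_euler wr).
  have K := cderivM (Psi_deriv wr) (cderivV wC (cderiv_id w%:C%C)).
  exact: (eq_ind _ (cderiv f w%:C%C) K _ DE).
suff <- : Psi x%:C%C / x%:C%C = dv a.
  rewrite cabsM cabsV cabs_real gtr0_norm// ler_pM2r ?invr_gt0//.
  by apply: Psi_le; rewrite cabs_real gtr0_norm.
(* The constant value of [Psi y / y] is identified by letting [y] tend to 0, where it tends to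
   [dPsi 0 = dv a]. *)
apply/eqP; rewrite -subr_eq0 -cabs_eq0; apply/eqP.
apply/le_anti; rewrite cabs_ge0 andbT; apply/ler_addgt0Pr => d d0; rewrite add0r.
have [|s s0 sP] := @Psi_deriv 0 _ _ d0; first by rewrite cabs0.
pose y := Num.min x (s / 2).
have y0 : 0 < y by rewrite lt_min x0 divr_gt0.
have yx : y <= x by rewrite ge_min lexx.
have ys : y < s.
  apply: (@le_lt_trans _ _ (s / 2)); first by rewrite ge_min lexx orbT.
  by rewrite ltr_pdivrMr// ltr_pMr// ltr1n.
have yC : y%:C%C != 0 :> R[i] by rewrite -cabs_gt0 cabs_real normr_gt0 gt_eqF.
rewrite -(const _ y0 yx).
have := sP y%:C%C; rewrite !subr0 Psi0 subr0 dPsi0 cabs_real gtr0_norm// => /(_ ys) H.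
rewrite (_ : _ - _ = (Psi y%:C%C - dv a * y%:C%C) / y%:C%C); last by field.
by rewrite cabsM cabsV cabs_real gtr0_norm// ler_pdivrMr.
Qed.

End Circle.
End CauchyEstimate.

(** * The Cesaro operator *)

Section CesaroOperator.
Variables (R : realType) (a : R).
Hypothesis a01 : 0 < a < 1.
Implicit Types (f g df : R[i] -> R[i]) (z w : R[i]) (M eps : R).

Let a0 : 0 < a. Proof. by case/andP: a01. Qed.
Let a1 : a < 1. Proof. by case/andP: a01. Qed.
Let a1' : 0 < 1 - a. Proof. by rewrite subr_gt0. Qed.

(** Numerator of the integrand: the Cesaro operator is the primitive of [weighted f w / w] along
    rays, so [radial_primitive] applies to it. *)
Definition weighted f w := f w * cesaro_weight a w.
Definition dweighted f df w := df w * cesaro_weight a w +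
  f w * (cesaro_weight a w * (a%:C%C / (1 - w))).

Definition cesaro_integrand f z (t : R) : R[i] :=
  let w : R[i] := Complex t 0 * z in f w * z / (w * cpow (1 - w) a).

Lemma cderiv_weighted f df M : bloch_bound a f df M ->
  forall z, cabs z < 1 -> cderiv (weighted f) z (dweighted f df z).
Proof.
by move=> fM z z1; apply: cderivM; [have [] := fM z z1|exact: cderiv_weight].
Qed.

Lemma dweighted_locally_bounded f df M : bloch_bound a f df M -> f 0 = 0 ->
  locally_bounded (dweighted f df).
Proof.
move=> fM f0 rho r1.
have [L L0 LP] := bloch_bound_locally_bounded (ltW a0) fM r1.
have M0 := bloch_bound_ge0 fM.
exists (L * (1 - rho) `^ (- a) + M / (1 - a) * ((1 - rho) `^ (- a) * (a / (1 - rho)))).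
  by rewrite addr_ge0// ?mulr_ge0 ?powR_ge0 ?invr_ge0 ?subr_ge0// ltW.
move=> z zr; apply: le_trans (cabsD _ _) _; rewrite cabsM [cabs (f z * _)]cabsM.
apply: lerD; apply: ler_pM; rewrite ?cabs_ge0 ?LP//.
- by apply: cabs_weight_le => //; exact: ltW.
- by apply: (bloch_bound_sup a01 fM) => //; exact: le_lt_trans zr r1.
- by apply: cabs_dweight_le => //; exact: ltW.
Qed.

Lemma weighted0 f : f 0 = 0 -> weighted f 0 = 0.
Proof. by move=> f0; rewrite /weighted f0 mul0r. Qed.

Lemma cesaro_integrandE f df z (t : R) : f 0 = 0 -> cabs z < 1 -> 0 < t <= 1 ->
  cesaro_integrand f z t = radial_kernel (weighted f) (dweighted f df) t z.
Proof.
move=> f0 z1 /andP[t0 t1]; rewrite /cesaro_integrand/= /radial_kernel gt_eqF//.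
rewrite /weighted cpow_weight; last first.
  rewrite cabsM cabs_real gtr0_norm//; apply: le_lt_trans z1.
  by rewrite ler_piMl ?cabs_ge0.
have [->|zn] := eqVneq z 0; first by rewrite !mulr0 f0 !mul0r mulr0.
rewrite -[Complex t 0]/(t%:C%C); move: (cpow _ _) (f _) => P V.
have tC : t%:C%C != 0 :> R[i] by rewrite -cabs_gt0 cabs_real normr_gt0 gt_eqF.
by rewrite [(_ * P)^-1]invfM; move: (P^-1) => Q; field; rewrite zn tC.
Qed.

Lemma cesaro_opE f df M z : bloch_bound a f df M -> f 0 = 0 -> cabs z < 1 ->
  cesaro_op a f z = radial_primitive (weighted f) (dweighted f df) z.
Proof.
move=> fM f0 z1; rewrite /cesaro_op asboolT//; apply: eq_cint01.
  apply: radial_kernel_integrable => //.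
  - exact: cderiv_weighted fM.
  - exact: weighted0.
by move=> t t01; exact: cesaro_integrandE.
Qed.

(** A substitute for the Schwarz lemma. For [|z| > 1/4] the factor 4 absorbs [|z|]. On [|w| <= 1/4],
    Cauchy's estimate at radius [1/4], inside the disc of radius [1/2] about [w], gives
    [|df w| <= 4 eps]; integrating from [f 0 = 0] gives the rest. *)
Lemma bloch_sup_div f df M eps z : bloch_bound a f df M -> f 0 = 0 ->
  (forall w, cabs w < 1 -> cabs (f w) <= eps) -> cabs z < 1 ->
  cabs (f z) <= 4 * eps * cabs z /\ cabs (df 0) <= 4 * eps.
Proof.
move=> fM f0 feps z1.
have cauchy w : cabs w <= 4^-1 -> cabs (df w) <= 4 * eps.
  move=> wq; rewrite [leRHS](_ : _ = eps / 4^-1); last by field.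
  apply: (@cauchy_estimate R f df _ _ w 2^-1).
  - by move=> x /fM[].
  - exact: bloch_bound_locally_bounded (ltW a0) fM.
  - by lra.
  - by lra.
  - by lra.
  - exact: feps.
have eps0 : 0 <= eps by apply: le_trans (feps z z1); exact: cabs_ge0.
split; last by apply: cauchy; rewrite cabs0; lra.
have [zq|/ltW zq] := leP (cabs z) 4^-1; last first.
  apply: le_trans (feps z z1) _; have := cabs_ge0 z; nra.
rewrite -[f z]subr0 -f0 -[in leRHS](subr0 z).
apply: (@cderiv_disc_lip R f df 4^-1); rewrite ?cabs0//.
- by lra.
- by move=> x /fM[].
Qed.

(** The new bound depends on [f] only through its supremum, and [M] has disappeared: this converts
    uniform convergence into Bloch convergence. The constant is [4 * 2], with 4 from [bloch_sup_div]
    and 2 from [2^a <= 2]. *)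
Lemma cesaro_bound f df M eps : bloch_bound a f df M -> f 0 = 0 ->
  (forall w, cabs w < 1 -> cabs (f w) <= eps) ->
  bloch_bound a (cesaro_op a f) (radial_derivative (dweighted f df)) (8 * eps).
Proof.
move=> fM f0 feps z z1.
have Fd := cderiv_weighted fM; have Fb := dweighted_locally_bounded fM f0.
have F0 := weighted0 f0.
have eps0 : 0 <= eps by apply: le_trans (feps z z1); exact: cabs_ge0.
split.
  apply: (@cderiv_local R (radial_primitive (weighted f) (dweighted f df))).
    exists (1 - cabs z) => [|w wz]; first by rewrite subr_gt0.
    rewrite (cesaro_opE fM f0)//; have := cabs_lerB w z; lra.
  exact: cderiv_radial_primitive.
have [fz df0] := bloch_sup_div fM f0 feps z1.
(* At the origin the relation [z * radial_derivative z = F z] says nothing; there the derivative is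
   [df 0], bounded by Cauchy's estimate. *)
have [z0|zn] := eqVneq z 0.
  rewrite z0 radial_derivative0 /dweighted weight0 mulr1 f0 mul0r addr0.
  rewrite cabs0 expr0n/= subr0 powR1 mul1r; lra.
have z0 : 0 < cabs z by rewrite cabs_gt0.
have E := radial_derivativeE Fd Fb F0 z1.
have w0 : 0 < cabs (1 - z) by exact/cabs_gt0_Re/Re_1B.
have {}E : cabs (radial_derivative (dweighted f df) z) =
    cabs (f z) / cabs z / cabs (1 - z) `^ a.
  have := congr1 (@cabs R) E; rewrite /weighted !cabsM cabs_weight// powRN => H.
  by apply: (mulfI (lt0r_neq0 z0)); rewrite H; field; rewrite !gt_eqF// powR_gt0.
rewrite E mulrA ler_pdivrMr ?powR_gt0// mulrC.
rewrite [leRHS](_ : _ = (4 * eps) * (2 * cabs (1 - z) `^ a)); last by ring.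
apply: ler_pM; rewrite ?divr_ge0 ?cabs_ge0 ?powR_ge0//.
  by rewrite ler_pdivrMr.
apply: (@le_trans _ _ ((2 * cabs (1 - z)) `^ a)).
  apply: ge0_ler_powR; rewrite ?nnegrE ?mulr_ge0 ?(ltW a0) ?(ltW w0) ?(ltW (disc_sqr z1))//.
  have := cabs_lerB 1 z; rewrite cabs1; nra.
rewrite powRM ?(ltW w0)// ler_wpM2r ?powR_ge0//.
by rewrite ler1_powR ?ler1n ?(ltW a1).
Qed.

Lemma cesaro_op0 f : cesaro_op a f 0 = 0.
Proof.
rewrite /cesaro_op asboolT /disc/= ?cabs0//.
rewrite -[RHS](cint01_cst 0); congr cint01; apply/funext => t.
by rewrite /= !mulr0 mul0r.
Qed.

Lemma cesaro_bloch0 f : bloch0 a f -> bloch0 a (cesaro_op a f).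
Proof.
move=> fB; have [M fM] := bloch0_bound fB; have [_ [f0 _]] := fB.
apply: (bloch_bound_bloch0 (cesaro_bound fM f0 _)) => //.
- by move=> w w1; exact: bloch_bound_sup a01 fM f0 w1.
- exact: cesaro_op0.
- by move=> z zD; rewrite /cesaro_op asboolF.
Qed.

Lemma bloch_bound_lin f g df dg M N (c d : R[i]) :
  bloch_bound a f df M -> bloch_bound a g dg N ->
  bloch_bound a (fun z => c * f z + d * g z) (fun z => c * df z + d * dg z)
    (cabs c * M + cabs d * N).
Proof.
move=> fM gN z z1; have [fd fb] := fM _ z1; have [gd gb] := gN _ z1.
split; first by apply: cderivD; exact: cderivZ.
set p := _ `^ a; have p0 : 0 <= p by exact: powR_ge0.
apply: (@le_trans _ _ (p * (cabs c * cabs (df z) + cabs d * cabs (dg z)))).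
  by rewrite ler_wpM2l// -!cabsM cabsD.
by rewrite mulrDr !(mulrCA p) lerD// ler_wpM2l ?cabs_ge0.
Qed.

Lemma bloch0_lin f g (c d : R[i]) : bloch0 a f -> bloch0 a g ->
  bloch0 a (fun z => c * f z + d * g z).
Proof.
move=> fB gB; have [M fM] := bloch0_bound fB; have [N gN] := bloch0_bound gB.
have [_ [f0 [foff _]]] := fB; have [_ [g0 [goff _]]] := gB.
apply: (bloch_bound_bloch0 (bloch_bound_lin c d fM gN)).
  by rewrite f0 g0 !mulr0 addr0.
by move=> z zD; rewrite foff// goff// !mulr0 addr0.
Qed.

Lemma cesaro_lin f g (c d : R[i]) : bloch0 a f -> bloch0 a g ->
  cesaro_op a (fun z => c * f z + d * g z) =
  (fun z => c * cesaro_op a f z + d * cesaro_op a g z).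
Proof.
move=> fB gB; have [M fM] := bloch0_bound fB; have [N gN] := bloch0_bound gB.
have [_ [f0 _]] := fB; have [_ [g0 _]] := gB.
apply/funext => z; have [z1|z1] := boolP (cabs z < 1); last first.
  have zD : ~ disc (z : Cplx R) by exact/negP.
  by rewrite /cesaro_op !asboolF// !mulr0 addr0.
rewrite (cesaro_opE fM f0 z1) (cesaro_opE gN g0 z1) /cesaro_op asboolT//.
have fi := radial_kernel_integrable (cderiv_weighted fM) (weighted0 f0) z1.
have gi := radial_kernel_integrable (cderiv_weighted gN) (weighted0 g0) z1.
rewrite /radial_primitive -!cint01Z// -cint01D; [|exact: cintegrableZ..].
apply: eq_cint01; first by apply: cintegrableD; exact: cintegrableZ.
move=> t t01; rewrite -!cesaro_integrandE// /cesaro_integrand/=.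
by rewrite !mulrDl -!mulrA.
Qed.

End CesaroOperator.

(** * Compactness *)

Section UltrafilterLimit.
Variables (R : realType) (U : set_system nat).
Context {UF : UltraFilter U}.

Lemma ultra_setVsetC (A : set nat) : ~ U A -> U (~` A).
Proof. by have [] := in_ultra_setVsetC A UF. Qed.

(** An ultrafilter [G] refining [s @ U] has a limit [l] in [[-C, C]] by compactness. If the set in
    question were not in [U], its complement would be, and [G] would contain both a ball around [l]
    and the complement of that ball. *)
Lemma real_ultra_limit (s : nat -> R) (C : R) : (forall n, `|s n| <= C) ->
  exists l : R, forall e : R, 0 < e -> U [set n | `|s n - l| <= e].
Proof.
move=> sC; have PF : ProperFilter (s @ U) by exact: fmap_proper_filter.
have [G [GU sG]] := ultraFilterLemma PF.
have GC : G `[- C, C]%classic.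
  apply: (sG `[- C, C]%classic).
  by apply: (@filterS _ U _ setT); [move=> n _ /=; rewrite in_itv/= -ler_norml|exact: filterT].
have := @segment_compact R (- C) C; rewrite compact_ultra => /(_ G GU GC)[l [_ Gl]].
exists l => e e0; apply: contrapT => /ultra_setVsetC H.
have G1 : G (ball l e) by apply: (Gl (ball l e)); exact: nbhsx_ballx.
have H2 : U (s @^-1` (~` ball l e)).
  apply: (@filterS _ U _ _ _ _ H) => n nH nB; apply: nH.
  by move: nB; rewrite /ball/= distrC => /ltW.
have G2 : G (~` ball l e) := sG _ H2.
have /filter_ex[x []//] : G (ball l e `&` ~` ball l e) by exact: filterI.
Qed.

Lemma complex_ultra_limit (s : nat -> R[i]) (C : R) : (forall n, cabs (s n) <= C) ->
  exists l : R[i], forall e : R, 0 < e -> U [set n | cabs (s n - l) <= e].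
Proof.
move=> sC.
have [x xP] := @real_ultra_limit (fun n => complex.Re (s n)) C
  (fun n => le_trans (Re_cabs _) (sC n)).
have [y yP] := @real_ultra_limit (fun n => complex.Im (s n)) C
  (fun n => le_trans (Im_cabs _) (sC n)).
exists (Complex x y) => e e0; have e2 : 0 < e / 2 by rewrite divr_gt0.
apply: filterS2 (xP _ e2) (yP _ e2) => n /= nx ny.
apply: le_trans (cabs_ReIm _) _; rewrite (splitr e).
by rewrite (raddfB (@complex.Re R)) (raddfB (@complex.Im R)) lerD.
Qed.

End UltrafilterLimit.

(** Splits the linearization error of a limit [v] by way of two approximants: [n] has its own
    linearization at [z], and [m] is close to [v] at the two points in play. *)
Lemma cabs_telescope (R : realType) (vw vz mw mz nw nz dn dm dv h : R[i]) :
  cabs (vw - vz - dv * h) <= cabs (mw - vw) + cabs (mz - vz) +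
    cabs ((nw - mw) - (nz - mz)) + cabs (nw - nz - dn * h) +
    cabs ((dn - dm) * h) + cabs ((dm - dv) * h).
Proof.
have -> : vw - vz - dv * h = - (mw - vw) + (mz - vz) - ((nw - mw) - (nz - mz)) +
    (nw - nz - dn * h) + (dn - dm) * h + (dm - dv) * h by ring.
do 3 (apply: le_trans (cabsD _ _) _; rewrite lerD2r).
apply: le_trans (cabsB _ _) _; rewrite lerD2r.
by apply: le_trans (cabsD _ _) _; rewrite lerD2r cabsN.
Qed.

Section Compactness.
Variables (R : realType) (a : R).
Hypothesis a01 : 0 < a < 1.
Variable u : nat -> Cplx R -> Cplx R.
Hypothesis u_bloch : forall n, bloch0 a (u n) /\ (bloch_norm a (u n) <= 1)%E.
Variable U : set_system nat.
Context {UF : UltraFilter U}.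

Let UI A B : U A -> U B -> U (A `&` B). Proof. exact: filterI. Qed.

Let du n := derive1 (u n).

Let u_bound n : bloch_bound a (u n) (du n) 1.
Proof. by have [[uh _] u1] := u_bloch n; exact: bloch_norm_bound. Qed.

Let u0 n : u n 0 = 0.
Proof. by have [[_ []]] := u_bloch n. Qed.

Let a0 : 0 < a. Proof. by case/andP: a01. Qed.

Let limit_exists : exists v, forall z (e : R), 0 < e -> U [set n | cabs (u n z - v z) <= e].
Proof.
suff H (z : R[i]) : exists l, forall e : R, 0 < e -> U [set n | cabs (u n z - l) <= e].
  by have [v vP] := choice H; exists v.
have [z1|z1] := boolP (cabs z < 1).
  apply: (@complex_ultra_limit R U _ (fun n => u n z) (1 / (1 - a))) => n.
  exact: bloch_bound_sup a01 (u_bound n) (u0 n) z1.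
exists 0 => e e0; apply: filterS filterT => n _ /=.
have [[_ [_ [off _]]] _] := u_bloch n.
by rewrite off ?subrr ?cabs0 ?ltW//; exact/negP.
Qed.

Let dlimit_exists : exists dv, forall z (e : R), cabs z < 1 -> 0 < e ->
  U [set n | cabs (du n z - dv z) <= e].
Proof.
suff H (z : R[i]) : exists l, forall e : R, cabs z < 1 -> 0 < e ->
    U [set n | cabs (du n z - l) <= e].
  by have [v vP] := choice H; exists v.
have [z1|z1] := boolP (cabs z < 1); last by exists 0 => e z1'; case/negP: z1.
have [|l lP] := @complex_ultra_limit R U _ (fun n => du n z) (1 / (1 - cabs z ^+ 2) `^ a).
  by move=> n; apply: (bloch_bound_le (ltW a0) (u_bound n)) => //; exact: cabs_ge0.
by exists l => e _; exact: lP.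
Qed.

Let uniform v : (forall z (e : R), 0 < e -> U [set n | cabs (u n z - v z) <= e]) ->
  forall e : R, 0 < e -> U [set n | forall z, cabs z < 1 -> cabs (u n z - v z) <= e].
Proof.
move=> vP e e0; apply: contrapT => /ultra_setVsetC bad.
have e4 : 0 < e / 4 by rewrite divr_gt0.
have e8 : 0 < e / 8 by rewrite divr_gt0.
have [d d0 dP] := bloch_equicontinuous a01 e4.
(* The points where convergence fails accumulate at some [z] of the closed disc;
   by equicontinuity it fails at any fixed point of the disc near [z]. *)
have [zs zsP] : exists zs : nat -> R[i], forall n, cabs (zs n) < 1 /\
    ((exists2 z, cabs z < 1 & e < cabs (u n z - v z)) -> e < cabs (u n (zs n) - v (zs n))).
  suff Z n : exists z : R[i], cabs z < 1 /\
    ((exists2 z, cabs z < 1 & e < cabs (u n z - v z)) -> e < cabs (u n z - v z)).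
    by have [zs zsP] := choice Z; exists zs.
  have [[z z1 H]|N] := pselect (exists2 z, cabs z < 1 & e < cabs (u n z - v z)).
    by exists z.
  by exists 0; rewrite cabs0.
have zs1 n : cabs (zs n) < 1 by have [] := zsP n.
have [z zP] := @complex_ultra_limit R U _ zs 1 (fun n => ltW (zs1 n)).
have d3 : 0 < d / 3 by rewrite divr_gt0.
(* The accumulation point [z] may lie on the unit circle, where nothing converges to a useful value,
   so [zs m] serves as the fixed point of the open disc. *)
have /filter_ex[m /= mz] := zP _ d3.
have I1 := UI (vP (zs m) _ e8) bad; have I2 := UI (zP _ d3) I1.
have /filter_ex[n /= [nz [nm nbad]]] := I2.
have H : e < cabs (u n (zs n) - v (zs n)).
  apply: (zsP n).2; apply: contra_notP nbad => N x x1.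
  by rewrite leNgt; apply/negP => xe; apply: N; exists x.
have nm_close : cabs (zs n - zs m) < d.
  apply: le_lt_trans (cabs_split z _ _) _; rewrite (cabsC z).
  by move: nz mz; lra.
(* No modulus of continuity is known for [v]; it is borrowed from some [u k] close to [v] at both
   points. In total [|u n (zs n) - v (zs n)|] is at most [7 e / 8], against the choice of [zs n]. *)
have /filter_ex[k /= [k1 k2]] := UI (vP (zs n) _ e8) (vP (zs m) _ e8).
have H1 := dP _ _ (u_bound n) _ _ (zs1 n) (zs1 m) nm_close.
have H2 := dP _ _ (u_bound k) _ _ (zs1 n) (zs1 m) nm_close.
have T1 := cabs_split (u n (zs m)) (u n (zs n)) (v (zs n)).
have T2 := cabs_split (v (zs m)) (u n (zs m)) (v (zs n)).
have T3 := cabs_split (u k (zs m)) (v (zs m)) (v (zs n)).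
have T4 := cabs_split (u k (zs n)) (u k (zs m)) (v (zs n)).
rewrite (cabsC (v (zs m)) (u k (zs m))) in T3; rewrite (cabsC (u k (zs m)) (u k (zs n))) in T4.
lra.
Qed.

(** Uniform closeness of [u n] and [u m] becomes closeness of their derivatives on a smaller disc by
    Cauchy's estimate for [u n - u m]; the limit and the derivative can then be exchanged. *)
Let limit_deriv v dv :
  (forall z (e : R), 0 < e -> U [set n | cabs (u n z - v z) <= e]) ->
  (forall z (e : R), cabs z < 1 -> 0 < e -> U [set n | cabs (du n z - dv z) <= e]) ->
  forall z, cabs z < 1 -> cderiv v z (dv z).
Proof.
move=> vP dvP z z1 e e0; have z0 := cabs_ge0 z.
pose x := (1 - cabs z) / 4; have x0 : 0 < x by rewrite /x; lra.
pose rho := (1 + cabs z) / 2; have rho1 : rho < 1 by rewrite /rho; lra.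
(* Two functions within [eta] of [v] differ by at most [2 eta], and Cauchy's estimate at radius [x]
   turns this into [2 eta / x = e / 8]. The disc of radius [2 * x = 1 - rho] about any [|w| <= rho]
   stays in the unit disc. *)
pose eta := e * x / 16; have eta0 : 0 < eta by rewrite divr_gt0// mulr_gt0.
have e8 : 0 < e / 8 by rewrite divr_gt0.
have e4 : 0 < e / 4 by rewrite divr_gt0.
have lip n m : (forall w, cabs w < 1 -> cabs (u n w - v w) <= eta) ->
    (forall w, cabs w < 1 -> cabs (u m w - v w) <= eta) ->
    cabs (du n z - du m z) <= e / 8 /\ forall w, cabs w <= rho ->
    cabs ((u n w - u m w) - (u n z - u m z)) <= e / 8 * cabs (w - z).
  move=> nv mv.
  have nm := bloch_bound_lin 1 (-1) (u_bound n) (u_bound m).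
  have dle w : cabs w <= rho -> cabs (1 * du n w + -1 * du m w) <= e / 8.
    move=> wr; rewrite [leRHS](_ : _ = (eta *+ 2) / x); last first.
      by rewrite /eta mulr2n; field; rewrite gt_eqF.
    apply: (@cauchy_estimate R (fun w => 1 * u n w + -1 * u m w)
      (fun w => 1 * du n w + -1 * du m w) _ _ w (2 * x)).
    - by move=> y /nm[].
    - exact: bloch_bound_locally_bounded (ltW a0) nm.
    - by move: wr; rewrite /rho /x; lra.
    - exact: x0.
    - by rewrite ltr_pMl ?ltr1n.
    - move=> y y1; rewrite mul1r mulN1r mulr2n.
      apply: le_trans (cabs_split (v y) _ _) _; apply: lerD; first exact: nv.
      by rewrite cabsC; exact: mv.
  split.
    by have := dle z; rewrite mul1r mulN1r; apply; rewrite /rho; lra.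
  move=> w wr; have := @cderiv_disc_lip R _ _ rho (e / 8) rho1 (fun y y1 => (nm y y1).1) dle z w.
  by rewrite !mul1r !mulN1r; apply=> //; rewrite /rho; lra.
have Ueta := uniform vP eta0.
have /filter_ex[n nv] := Ueta; rewrite /= in nv.
have [nd _] := u_bound n z1; have [r r0 rP] := nd _ e4.
exists (Num.min r (2 * x)) => [|w]; first by rewrite lt_min r0 mulr_gt0.
rewrite lt_min => /andP[wr wx].
have [->|wz] := eqVneq w z; first by rewrite !subrr mulr0 subr0 cabs0 mulr0.
have wz0 : 0 < cabs (w - z) by rewrite cabs_gt0 subr_eq0.
have w_rho : cabs w <= rho.
  by have := cabs_lerB w z; move: wx; rewrite /rho /x; lra.
(* The order of choices matters: [n] is fixed before [w] because it determines the radius [r],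
   whereas [m] comes after [w] and is precise relative to [|w - z|]. *)
have t0 : 0 < e / 16 * cabs (w - z) by rewrite mulr_gt0// divr_gt0.
have I1 := UI (vP z _ t0) (dvP z _ z1 e8); have I2 := UI (vP w _ t0) I1.
have I3 := UI Ueta I2; have /filter_ex[m /= [mv [mw [mz mdz]]]] := I3.
have [L1 L2] := lip n m nv mv.
have H1 := L2 w w_rho; have H2 := rP w wr.
have H3 : cabs ((du n z - du m z) * (w - z)) <= e / 8 * cabs (w - z).
  by rewrite cabsM ler_wpM2r// ltW.
have H4 : cabs ((du m z - dv z) * (w - z)) <= e / 8 * cabs (w - z).
  by rewrite cabsM ler_wpM2r// ltW.
apply: le_trans (cabs_telescope (v w) (v z) (u m w) (u m z) (u n w) (u n z)
  (du n z) (du m z) (dv z) (w - z)) _.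
have : 0 < e * cabs (w - z) by rewrite mulr_gt0.
lra.
Qed.

Lemma bloch_ultra_limit : exists2 v, bloch0 a v & forall e : R, 0 < e ->
  U [set n | forall z, cabs z < 1 -> cabs (u n z - v z) <= e].
Proof.
have [v vP] := limit_exists; have [dv dvP] := dlimit_exists.
exists v; last exact: uniform.
have v_eq0 z : (forall n, u n z = 0) -> v z = 0.
  move=> uz; apply/eqP; rewrite -cabs_eq0; apply/eqP/le_anti; rewrite cabs_ge0 andbT.
  apply/ler_addgt0Pr => e e0; rewrite add0r.
  by have /filter_ex[n /=] := vP z e e0; rewrite uz sub0r cabsN.
apply: (@bloch_bound_bloch0 R a v dv 1).
- move=> z z1; split; first exact: limit_deriv.
  have p0 : 0 < (1 - cabs z ^+ 2) `^ a by rewrite powR_gt0// disc_sqr.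
  apply/ler_addgt0Pr => e e0.
  have /filter_ex[n /= nz] := dvP z _ z1 (divr_gt0 e0 p0).
  have [_ H] := u_bound n z1.
  have := cabs_lerB (dv z) (du n z); rewrite cabsC => H2.
  rewrite [1 + e]addrC -lerBlDr; apply: le_trans (lerB (lexx _) H) _.
  rewrite -mulrBr -ler_pdivlMl// mulrC; exact: le_trans H2 nz.
- exact: v_eq0.
- by move=> z zD; apply: v_eq0 => n; have [[_ [_ [off _]]] _] := u_bloch n; exact: off.
Qed.

End Compactness.

(** * Compactness of the operator and its essential norm *)

Section CesaroCompact.
Variables (R : realType) (a : R).
Hypothesis a01 : 0 < a < 1.

Let bloch_bound0 : bloch_bound a (fun=> 0 : R[i]) (fun=> 0) 0.
Proof.
move=> z _; split; first exact: cderiv_cst.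
by rewrite cabs0 mulr0.
Qed.

Lemma compact_opp_cesaro : compact_op a (fun (f : Cplx R -> Cplx R) z => - cesaro_op a f z).
Proof.
(* Negation is written as a linear combination, so that linearity and invariance of the space apply
   to it. *)
have oppE (f : Cplx R -> Cplx R) : bloch0 a f ->
    (fun z => - cesaro_op a f z) = cesaro_op a (fun z => (-1) * f z + 0 * f z).
  move=> fB; rewrite (cesaro_lin (-1) 0 fB fB); apply/funext => z.
  by rewrite mul0r addr0 mulN1r.
have oppB (f : Cplx R -> Cplx R) : bloch0 a f -> bloch0 a (fun z => - cesaro_op a f z).
  move=> fB; rewrite (oppE f fB); apply: (cesaro_bloch0 a01).
  exact: (bloch0_lin (-1) 0 fB fB).
split; first exact: oppB.
split.
  move=> c d f g fB gB; rewrite (cesaro_lin c d fB gB); apply/funext => z.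
  by rewrite opprD !mulrN.
move=> u uB.
(* [U] refines [\oo], so each of its members contains arbitrarily large indices; this is what allows
   increasing choices below. *)
have [U [UF Uoo]] := @ultraFilterLemma _ (\oo : set_system nat) _.
have [v vB vU] := @bloch_ultra_limit R a a01 u uB U UF.
have next (N k : nat) : exists n, (N < n)%N /\
    forall z, cabs z < 1 -> cabs (u n z - v z) <= k.+1%:R^-1.
  have k0 : 0 < k.+1%:R^-1 :> R by rewrite invr_gt0 ltr0Sn.
  have HN : U [set n | (N < n)%N] by apply: Uoo; exists N.+1.
  have /filter_ex[n [/= Nn nP]] : U ([set n | (N < n)%N] `&`
    [set n | forall z, cabs z < 1 -> cabs (u n z - v z) <= k.+1%:R^-1]).
    by apply: filterI => //; exact: vU.
  by exists n.
have {}next (p : nat * nat) : exists n, (p.1 < n)%N /\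
    forall z, cabs z < 1 -> cabs (u n z - v z) <= p.2.+1%:R^-1.
  exact: next.
have [sel selP] := choice next.
(* The pair given to [sel] holds the previous index, to be exceeded, and the rank, which fixes the
   precision [1 / (k + 1)]. *)
pose phi := fix phi k := if k is k'.+1 then sel (phi k', k) else sel (0, 0)%N.
have phi_lt n : (phi n < phi n.+1)%N by have [] := selP (phi n, n.+1).
have phiP n z : cabs z < 1 -> cabs (u (phi n) z - v z) <= n.+1%:R^-1.
  by case: n => [|n]; [have [_] := selP (0, 0)%N|have [_] := selP (phi n, n.+1)]; apply.
exists phi; split=> //; exists (fun z => - cesaro_op a v z); split.
  exact: oppB.
(* The factor 8 of [cesaro_bound] times [e / 9] stays below [e]. *)
move=> e e0; have e8 : 0 < e / 9 by rewrite divr_gt0.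
have /cvgrPdist_lt/(_ _ e8) := @cvg_harmonic R.
apply: filterS => n; rewrite sub0r normrN ger0_norm ?invr_ge0// => ne.
have [unB _] := uB (phi n).
have -> : (fun z => - cesaro_op a (u (phi n)) z - - cesaro_op a v z) =
    cesaro_op a (fun z => (-1) * u (phi n) z + 1 * v z).
  rewrite (cesaro_lin (-1) 1 unB vB); apply/funext => z.
  by rewrite mulN1r mul1r opprK.
have [M uM] := bloch0_bound unB; have [N vN] := bloch0_bound vB.
have D := bloch_bound_lin (-1) 1 uM vN.
have [_ [u00 _]] := unB; have [_ [v00 _]] := vB.
have D0 : -1 * u (phi n) 0 + 1 * v 0 = 0 by rewrite u00 v00 !mulr0 addr0.
have Dle w : cabs w < 1 -> cabs (-1 * u (phi n) w + 1 * v w) <= n.+1%:R^-1.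
  by move=> w1; rewrite mulN1r mul1r addrC cabsC; exact: phiP.
apply: le_lt_trans (bloch_norm_le (cesaro_bound a01 D D0 Dle)) _.
rewrite lte_fin; have : 8 * n.+1%:R^-1 < 8 * (e / 9) by rewrite ltr_pM2l.
move: (_^-1) => x; lra.
Qed.

(** The zero function belongs to the unit ball, so the supremum is not the empty one, which would be
    [-oo]; no assumption on [T] is needed because any Bloch norm is nonnegative. *)
Lemma opnorm_ge0 (T : (Cplx R -> Cplx R) -> (Cplx R -> Cplx R)) : (0 <= opnorm a T)%E.
Proof.
apply: le_trans (ereal_sup_ubound _); first exact: (bloch_norm_ge0 a (T (fun=> 0))).
exists (fun=> 0) => //=; split.
  exact: (bloch_bound_bloch0 bloch_bound0).
by apply: le_trans (bloch_norm_le bloch_bound0) _; rewrite lee_fin.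
Qed.

Lemma ess_norm_cesaro : ess_norm a (@cesaro_op R a) = 0%E.
Proof.
apply/le_anti/andP; split; last first.
  by apply: le_ereal_inf_tmp => _ [K _ <-]; exact: opnorm_ge0.
apply: (@le_trans _ _ (opnorm a (fun f z => cesaro_op a f z + - cesaro_op a f z))).
  apply: ereal_inf_lbound; exists (fun f z => - cesaro_op a f z).
    exact: compact_opp_cesaro.
  reflexivity.
apply: ge_ereal_sup => _ [f _ <-].
have -> : (fun z => cesaro_op a f z + - cesaro_op a f z) = (fun=> 0).
  by apply/funext => z; rewrite subrr.
exact: bloch_norm_le bloch_bound0.
Qed.

End CesaroCompact.

(** The first conjunct makes [cesaro_op beta] an operator on the space; the second alone would not
    say so, as [opnorm] accepts any map of functions. *)
Theorem theorem4p4 (R : realType) (alpha beta : R) :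
  0 < alpha -> alpha < 1 -> beta = alpha ->
  (forall f, bloch0 alpha f -> bloch0 alpha (cesaro_op beta f)) /\
  ess_norm alpha (cesaro_op beta) = 0%E.
Proof.
move=> alpha_gt0 alpha_lt1 ->.
have alpha01 : 0 < alpha < 1 by rewrite alpha_gt0.
split; last exact: ess_norm_cesaro.
by move=> f; exact: cesaro_bloch0.
Qed.
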